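(* Let $\boldsymbol\gamma=\{\gamma_n\}_{n=0}^{\infty}$ be a sequence of real numbers such that $\limsup_{n\to\infty}|\gamma_n|^{1/n}<\infty$. Then the following conditions are equivalent: (i) $\boldsymbol\gamma$ is PD; (ii) $\boldsymbol\gamma$ is a Hamburger moment sequence; (iii) $\boldsymbol\gamma$ is CPD, $\int_{\mathbb{R}}\frac{1}{(x-1)^2}\,\mathrm{d}\nu(x)\leq\gamma_0$, $b=\int_{\mathbb{R}}\frac{1}{x-1}\,\mathrm{d}\nu(x)$ and $c=0$, where $(b,c,\nu)$ is the representing triplet of $\boldsymbol\gamma$. Moreover, if (iii) holds, then $\boldsymbol\gamma$ is a determinate Hamburger moment sequence, its unique representing measure $\mu$ is compactly supported, and the following identities hold: $$\mu(\Delta)=\int_{\Delta}\frac{1}{(x-1)^2}\,\mathrm{d}\nu(x)+\Big(\gamma_0-\int_{\mathbb{R}}\frac{1}{(x-1)^2}\,\mathrm{d}\nu(x)\Big)\delta_1(\Delta),\quad \Delta\in\mathfrak{B}(\mathbb{R}),$$ $$b=\int_{\mathbb{R}}(x-1)\,\mathrm{d}\mu(x),$$ $$\nu(\Delta)=\int_{\Delta}(x-1)^2\,\mathrm{d}\mu(x),\quad \Delta\in\mathfrak{B}(\mathbb{R}).$$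
   Context: $\mathfrak{B}(\mathbb{R})$ is the Borel $\sigma$-algebra of $\mathbb{R}$; measures are positive; $\delta_1$ is the Dirac measure at $1$; $\mathbb{Z}_+=\{0,1,2,\ldots\}$, $\mathbb{R}_+=[0,\infty)$. A real sequence $\{\gamma_n\}_{n=0}^\infty$ is positive definite (PD) if $\sum_{i,j=0}^k \gamma_{i+j}\lambda_i\bar\lambda_j\geq 0$ for all finite complex sequences $\lambda_0,\ldots,\lambda_k$; it is conditionally positive definite (CPD) if the same inequality holds for all finite complex sequences with $\sum_{i=0}^k\lambda_i=0$. It is a Hamburger moment sequence if there is a Borel measure $\mu$ on $\mathbb{R}$ (a representing measure) with $\gamma_n=\int_{\mathbb{R}} t^n\,\mathrm{d}\mu(t)$ for all $n\in\mathbb{Z}_+$; it is determinate if this measure on $\mathbb{R}$ is unique. Let $Q_0=Q_1=0$ and $Q_n(x)=\sum_{j=0}^{n-2}(n-j-1)x^j$ for $n\geq2$. For a CPD sequence with $\limsup_{n\to\infty}|\gamma_n|^{1/n}<\infty$ there is a unique triplet $(b,c,\nu)$, called its representing triplet, with $b\in\mathbb{R}$, $c\in\mathbb{R}_+$ and $\nu$ a finite compactly supported Borel measure on $\mathbb{R}$ with $\nu(\{1\})=0$, such that $\gamma_n=\gamma_0+bn+cn^2+\int_{\mathbb{R}}Q_n\,\mathrm{d}\nu$ for all $n\in\mathbb{Z}_+$. (If $\int\frac{1}{(x-1)^2}\mathrm{d}\nu<\infty$, then $\frac{1}{x-1}\in L^1(\nu)$, so the integral for $b$ in (iii) makes sense.)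 *)

(* Defs.v *)
From mathcomp Require Import all_boot all_order all_algebra.
From mathcomp Require Import all_classical all_reals all_analysis.
From mathcomp Require Import complex.
Import Order.TTheory GRing.Theory Num.Theory.
Import numFieldNormedType.Exports.

Set Implicit Arguments.
Unset Strict Implicit.
Unset Printing Implicit Defensive.

Local Open Scope classical_set_scope.
Local Open Scope ring_scope.

(* The order of R[i] is the partial order in which 0 <= z means that z is real
   and nonnegative; gamma being real, hankel_form is always real.                             *)

Definition hankel_form (R : realType) (gamma : R^nat) (k : nat)
    (lambda : 'I_k.+1 -> R[i]) : R[i] :=
  \sum_(i < k.+1) \sum_(j < k.+1)
    (gamma (i + j)%N)%:C%C * lambda i * (lambda j)^*%R.

Definition positive_definite (R : realType) (gamma : R^nat) : Prop :=
  forall (k : nat) (lambda : 'I_k.+1 -> R[i]), 0 <= hankel_form gamma lambda.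

Definition conditionally_positive_definite (R : realType) (gamma : R^nat) :
    Prop :=
  forall (k : nat) (lambda : 'I_k.+1 -> R[i]),
    \sum_(i < k.+1) lambda i = 0 -> 0 <= hankel_form gamma lambda.

(* At index 0 the exponent is 0^-1 = 0, which is irrelevant for the limsup.  *)
Definition at_most_exponential (R : realType) (gamma : R^nat) : Prop :=
  (limn_esup (fun n => (`|gamma n| `^ (n%:R^-1))%:E) < +oo)%E.

Definition represents (R : realType)
    (mu : {measure set (measurableTypeR R) -> \bar R}) (gamma : R^nat) : Prop :=
  forall n : nat,
    mu.-integrable [set: measurableTypeR R] (fun t => (t ^+ n)%:E) /\
    (gamma n)%:E = (\int[mu]_t (t ^+ n)%:E)%E.

Definition hamburger_moment_sequence (R : realType) (gamma : R^nat) : Prop :=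
  exists mu : {measure set (measurableTypeR R) -> \bar R}, represents mu gamma.

Definition determinate (R : realType) (gamma : R^nat) : Prop :=
  hamburger_moment_sequence gamma /\
  forall mu1 mu2 : {measure set (measurableTypeR R) -> \bar R},
    represents mu1 gamma -> represents mu2 gamma ->
    forall A : set (measurableTypeR R), measurable A -> mu1 A = mu2 A.

Definition closed_support (R : realType)
    (mu : {measure set (measurableTypeR R) -> \bar R}) : set R :=
  [set x | forall U : set R, open U -> U x -> (0 < mu U)%E].

Definition compactly_supported (R : realType)
    (mu : {measure set (measurableTypeR R) -> \bar R}) : Prop :=
  compact (closed_support mu).

(* The truncated predecessor makes this 0 for n = 0 and n = 1.               *)
Definition Q (R : realType) (n : nat) : {poly R} :=
  \poly_(j < n.-1) (n - j - 1)%:R.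

Definition representing_triplet (R : realType) (gamma : R^nat) (b c : R)
    (nu : {finite_measure set (measurableTypeR R) -> \bar R}) : Prop :=
  [/\ 0 <= c, compactly_supported nu, nu [set 1] = 0%E
    & forall n : nat,
        (gamma n)%:E = ((gamma 0%N + b * n%:R + c * n%:R ^+ 2)%:E
                        + \int[nu]_x ((Q R n).[x])%:E)%E].

(* Since 0^-1 = 0, the integrands vanish at x = 1, which is a null set of the
   measure of a representing triplet.                                        *)
Definition triplet_conditions (R : realType) (gamma : R^nat) (b c : R)
    (nu : {finite_measure set (measurableTypeR R) -> \bar R}) : Prop :=
  [/\ (\int[nu]_x ((x - 1) ^- 2)%:E <= (gamma 0%N)%:E)%E,
      b%:E = (\int[nu]_x ((x - 1)^-1)%:E)%E
    & c = 0].

(* Main.v *)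
(* (i) => (ii): let L be the functional with L(X^n) = gamma_n, nonnegative on
   squares.  Log-convexity of k |-> L(X^(2k) q^2) and |gamma_n| <= C r^n give
   L((r^2 - X^2) q^2) >= 0, so L is nonnegative on (r + X)^k (r - X)^l.  After an
   affine change of variable to [0, 1] the values of L on the Bernstein basis are
   weights of discrete measures on {k/n}, whose moments tend to those of L.
   Determinacy: a representing measure lives on [-r, r], and on [0, 1] the
   polynomials (1 - s^n)^N_n converge boundedly to indicators of initial segments.
   (ii) <=> (iii): Q_n(x) (x - 1)^2 = x^n - 1 - n (x - 1), so mu and nu are
   related by the density (x - 1)^2 away from 1. *)
From HB Require Import structures.
Require Import Defs.
From mathcomp Require Import all_boot all_order all_algebra.
From mathcomp Require Import all_classical all_reals all_analysis.
From mathcomp Require Import measurable_realfun complex.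
From mathcomp Require Import ring lra zify.
Import Order.TTheory GRing.Theory Num.Theory.
Import numFieldNormedType.Exports.

Local Open Scope classical_set_scope.
Local Open Scope ring_scope.

(** * Positive functionals on polynomials *)

Section MomentFunctional.
Context {R : realType}.
Implicit Types (gamma : R^nat) (p q : {poly R}).

(** A single bound [|gamma n| <= C * r ^+ n] replaces the limsup: it makes the functional positive
    on r^2 - X^2 times squares, and it confines every representing measure to [-r, r]. The limit
    measure is obtained without a representation theorem for functionals: a discrete measure of mass
    M on [0, 1] is the image of Lebesgue measure on ]0, M] under its quantile function, so a limit
    of measures becomes a pointwise limit of monotone functions. Between mu and nu the point 1 is
    the obstacle. The factor (x - 1)^2 erases an atom of mu at 1; its mass is the gap in the
    inequality with gamma_0, and the formula for mu restores it as a multiple of the Dirac mass.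
    Uniqueness of the triplet is proved, and the identities for b and nu come from comparing the
    given triplet with the one built from mu. *)

Definition moment_functional gamma p : R := \sum_(i < size p) p`_i * gamma i.

Lemma moment_functional_widen gamma p n : (size p <= n)%N ->
  moment_functional gamma p = \sum_(i < n) p`_i * gamma i.
Proof.
move=> pn; rewrite /moment_functional (big_ord_widen n (fun i => p`_i * gamma i))//.
rewrite big_mkcond/=; apply: eq_bigr => i _.
by case: ltnP => // ni; rewrite nth_default// mul0r.
Qed.

Lemma moment_functional_is_linear gamma :
  scalar (moment_functional gamma).
Proof.
move=> a p q; pose n := maxn (size p) (size q).
rewrite (@moment_functional_widen _ _ n); last first.
  rewrite (leq_trans (size_polyD _ _))// geq_max leq_maxr andbT.
  by rewrite (leq_trans (size_scale_leq _ _))// leq_maxl.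
rewrite (@moment_functional_widen _ p n) ?leq_maxl//.
rewrite (@moment_functional_widen _ q n) ?leq_maxr//.
rewrite mulr_sumr -big_split/=; apply: eq_bigr => i _.
by rewrite coefD coefZ mulrDl mulrA.
Qed.

HB.instance Definition _ gamma :=
  GRing.isLinear.Build R {poly R} R *%R (moment_functional gamma)
    (moment_functional_is_linear gamma).

Lemma moment_functionalXn gamma n : moment_functional gamma 'X^n = gamma n.
Proof.
rewrite (@moment_functional_widen _ _ n.+1) ?size_polyXn//.
rewrite big_ord_recr/= big1 ?add0r; last first.
  by move=> i _; rewrite coefXn ltn_eqF ?mul0r.
by rewrite coefXn eqxx mul1r.
Qed.

Lemma moment_functional_mul gamma k (a b : 'I_k -> R) :
  moment_functional gamma ((\sum_(i < k) a i *: 'X^i) * (\sum_(i < k) b i *: 'X^i)) =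
  \sum_(i < k) \sum_(j < k) gamma (i + j)%N * (a i * b j).
Proof.
rewrite mulr_suml linear_sum/=; apply: eq_bigr => i _.
rewrite mulr_sumr linear_sum/=; apply: eq_bigr => j _.
by rewrite -scalerAl -scalerAr scalerA -exprD linearZ/= moment_functionalXn mulrC.
Qed.

(** With lambda = a + i b, the cross terms are antisymmetric in the two indices while
    [gamma (i + j)] is symmetric, so they cancel once the sums are exchanged. *)
Lemma hankel_formE gamma k (lambda : 'I_k.+1 -> R[i]) :
  hankel_form gamma lambda =
  (moment_functional gamma ((\sum_(i < k.+1) complex.Re (lambda i) *: 'X^i) ^+ 2) +
   moment_functional gamma ((\sum_(i < k.+1) complex.Im (lambda i) *: 'X^i) ^+ 2))%:C%C.
Proof.
rewrite !expr2 !moment_functional_mul -big_split/=.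
set a := fun i => complex.Re (lambda i); set b := fun i => complex.Im (lambda i).
have -> : hankel_form gamma lambda = \sum_(i < k.+1) \sum_(j < k.+1)
    ((gamma (i + j)%N * (a i * a j) + gamma (i + j)%N * (b i * b j))%:C%C +
     'i%C * ((gamma (i + j)%N * (b i * a j))%:C%C - (gamma (i + j)%N * (a i * b j))%:C%C)).
  apply: eq_bigr => i _; apply: eq_bigr => j _; rewrite /a /b.
  case: (lambda i) (lambda j) => [x y] [z t] /=; simpc.
  by apply/eqP; rewrite eq_complex/=; apply/andP; split; apply/eqP; ring.
under [LHS]eq_bigr => i _ do rewrite big_split/= -mulr_sumr sumrB.
rewrite big_split/= -mulr_sumr sumrB.
rewrite [X in _ - X]exchange_big/=.
rewrite [X in _ - X](_ : _ =
    \sum_(i < k.+1) \sum_(j < k.+1) (gamma (i + j)%N * (b i * a j))%:C%C).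
  rewrite subrr mulr0 addr0 rmorph_sum/=; apply: eq_bigr => i _.
  by rewrite -rmorph_sum/= big_split.
by apply: eq_bigr => i _; apply: eq_bigr => j _; rewrite addnC [a j * _]mulrC.
Qed.

Lemma positive_definiteP gamma :
  positive_definite gamma <-> forall p, 0 <= moment_functional gamma (p ^+ 2).
Proof.
split=> [pd p|pos k lambda]; last by rewrite hankel_formE lecR addr_ge0.
(* The index range has one element more than p has coefficients; the extra coefficient is 0. *)
have := pd (size p) (fun i => (p`_i)%:C%C).
rewrite hankel_formE lecR/=.
have -> : \sum_(i < (size p).+1) p`_i *: 'X^i = p.
  by rewrite big_ord_recr/= nth_default// scale0r addr0 -poly_def coefK.
have -> : \sum_(i < (size p).+1) (0 : R) *: 'X^i = 0 :> {poly R}.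
  by rewrite big1// => i _; rewrite scale0r.
by rewrite expr0n/= linear0 addr0.
Qed.

Lemma moment_functional_cauchy_schwarz gamma p q :
  (forall f, 0 <= moment_functional gamma (f ^+ 2)) ->
  moment_functional gamma (p * q) ^+ 2 <=
  moment_functional gamma (p ^+ 2) * moment_functional gamma (q ^+ 2).
Proof.
move=> pos; set L := moment_functional gamma.
have h (s t : R) : 0 <= s ^+ 2 * L (p ^+ 2) + 2 * s * t * L (p * q) + t ^+ 2 * L (q ^+ 2).
  have := pos (s *: p + t *: q).
  rewrite (_ : (_ + _) ^+ 2 = s ^+ 2 *: p ^+ 2 + (2 * s * t) *: (p * q) + t ^+ 2 *: q ^+ 2).
    by rewrite !linearD/= !linearZ.
  by rewrite -!mul_polyC !polyCM; ring.
have p0 := pos p; have q0 := pos q; rewrite -/(L _) in p0 q0.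
have [pz|pnz] := eqVneq (L (p ^+ 2)) 0.
  have [->|nz] := eqVneq (L (p * q)) 0; first by rewrite expr0n mulr_ge0.
  (* The form is now affine in s, and this s makes it equal to -1. *)
  have := h (- (L (q ^+ 2) + 1) / (2 * L (p * q))) 1.
  rewrite pz (_ : _ + _ = - 1) ?ler0N1// ; last by field.
have pp : 0 < L (p ^+ 2) by rewrite lt_neqAle eq_sym pnz.
(* This is the minimizer s / t = - L (p q) / L (p^2) of the form, cleared of its denominator. *)
have := h (- L (p * q)) (L (p ^+ 2)).
rewrite (_ : _ + _ = L (p ^+ 2) * (L (p ^+ 2) * L (q ^+ 2) - L (p * q) ^+ 2)); last by ring.
by rewrite pmulr_rge0// subr_ge0.
Qed.

(* The ratios a_(k+1) / a_k are nondecreasing, hence a first ratio above rho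
   would make a grow faster than rho ^ k. *)
Lemma log_convex_growth (a : R^nat) (K rho : R) : 0 < rho ->
  (forall k, 0 <= a k) -> (forall k, a k.+1 ^+ 2 <= a k * a k.+2) ->
  (forall k, a k <= K * rho ^+ k) -> a 1%N <= rho * a 0%N.
Proof.
move=> rho0 a0 acvx abnd; rewrite leNgt; apply/negP => lt1.
have a00 : 0 < a 0%N.
  rewrite lt_neqAle a0 andbT; apply/eqP => az.
  have := acvx 0%N; rewrite -az mul0r real_exprn_even_le0//= ?num_real// => /eqP a1.
  by move: lt1; rewrite a1 -az mulr0 ltxx.
pose x := a 1%N / a 0%N.
have xrho : rho < x by rewrite /x ltr_pdivlMr.
have x0 : 0 < x by exact: lt_trans xrho.
have step k : 0 < a k /\ x * a k <= a k.+1.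
  elim: k => [|k [ak IH]]; first by split=> //; rewrite /x divfK// gt_eqF.
  have ak1 : 0 < a k.+1 by rewrite (lt_le_trans _ IH)// mulr_gt0.
  split=> //; rewrite -(ler_pM2l ak) (le_trans _ (acvx k))//.
  by rewrite mulrCA mulrA expr2 ler_pM2r.
have low k : a 0%N * x ^+ k <= a k.
  elim: k => [|k IH]; first by rewrite mulr1.
  by rewrite (le_trans _ (step k).2)// exprS mulrCA ler_pM2l.
pose h := x / rho - 1.
have h0 : 0 < h by rewrite subr_gt0 ltr_pdivlMr// mul1r.
(* Bernoulli's inequality: linear growth of (x / rho)^k already contradicts the bound K, by the
   Archimedean property. *)
have bern k : 1 + k%:R * h <= (x / rho) ^+ k.
  elim: k => [|k IH]; first by rewrite mul0r addr0.
  rewrite exprSr -natr1 (le_trans _ (ler_wpM2r _ IH))//; last by rewrite divr_ge0 ?ltW.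
  rewrite (_ : x / rho = 1 + h); last by rewrite /h; ring.
  rewrite (_ : (1 + _) * _ = 1 + (k%:R + 1) * h + k%:R * h ^+ 2); last by ring.
  by rewrite lerDl mulr_ge0 ?sqr_ge0.
have bnd k : a 0%N * (1 + k%:R * h) <= K.
  rewrite (le_trans (ler_wpM2l (a0 _) (bern k)))// expr_div_n mulrA ler_pdivrMr ?exprn_gt0//.
  exact: le_trans (low k) (abnd k).
pose N := Num.bound `|K / (a 0%N * h)|.
have : K / (a 0%N * h) < N%:R.
  by apply: le_lt_trans (ler_norm _) _; exact: archi_boundP.
rewrite ltr_pdivrMr ?mulr_gt0// ltNge => /negP; apply.
rewrite (le_trans _ (bnd N))// (_ : _ * (1 + _) = a 0%N + N%:R * (a 0%N * h)); last by ring.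
by rewrite lerDr ltW.
Qed.

Section PositiveBoundedFunctional.
Variables (gamma : R^nat) (C r : R).
Hypotheses (r0 : 0 < r) (growth : forall n, `|gamma n| <= C * r ^+ n).
Hypothesis pos : forall p, 0 <= moment_functional gamma (p ^+ 2).
Local Notation L := (moment_functional gamma).

(* a_k = L ((X ^ k p) ^ 2) is log-convex by Cauchy-Schwarz. *)
Lemma positive_functional_bound p : 0 <= L ((r ^+ 2)%:P * p ^+ 2 - 'X ^+ 2 * p ^+ 2).
Proof.
rewrite linearB/= mul_polyC linearZ/= subr_ge0.
pose a k := L (('X ^+ k * p) ^+ 2).
(* The constant comes from expanding (X^k p)^2 in monomials X^(i + 2k), whose moments are at most C
   r^i (r^2)^k in absolute value. *)
have := @log_convex_growth a (\sum_(i < size (p ^+ 2)) `|(p ^+ 2)`_i| * (C * r ^+ i)) (r ^+ 2).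
rewrite /a expr0 mul1r expr1 exprMn; apply.
- by rewrite exprn_gt0.
- by move=> k; exact: pos.
- move=> k; rewrite [X in L X ^+ 2](_ : _ = ('X ^+ k * p) * ('X ^+ k.+2 * p)).
    exact: moment_functional_cauchy_schwarz.
  by rewrite !exprS; ring.
- move=> k; rewrite (_ : (_ * p) ^+ 2 = \sum_(i < size (p ^+ 2)) (p ^+ 2)`_i *: 'X^(i + 2 * k)).
    rewrite linear_sum/= mulr_suml (le_trans (ler_norm _))//.
    rewrite (le_trans (ler_norm_sum _ _ _))//; apply: ler_sum => i _.
    rewrite linearZ/= moment_functionalXn normrM -mulrA ler_wpM2l//.
    by rewrite (le_trans (growth _))// -mulrA -exprM -exprD.
  rewrite exprMn -exprM mulnC -[X in _ * X]coefK poly_def mulr_sumr.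
  by apply: eq_bigr => i _; rewrite -scalerAr -exprD addnC.
Qed.

(** By parity the product is a square times 1, r + X, r - X or (r + X)(r - X). The last case is
    [positive_functional_bound]; the linear factors reduce to it by 2r(r + X) = (r + X)^2 + (r +
    X)(r - X) and its mirror image. *)
Lemma positive_functional_bernstein k l :
  0 <= L ((r%:P + 'X) ^+ k * (r%:P - 'X) ^+ l).
Proof.
have P2 p : 0 <= L ((r%:P + 'X) * (r%:P - 'X) * p ^+ 2).
  have := positive_functional_bound p.
  by rewrite -mulrBl polyC_exp subr_sqr [_ * (r%:P + _)]mulrC.
have scale q : 0 <= L ((2 * r)%:P * q) -> 0 <= L q.
  by rewrite mul_polyC linearZ/= pmulr_rge0// mulr_gt0.
have Pp p : 0 <= L ((r%:P + 'X) * p ^+ 2).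
  apply: scale; rewrite (_ : _ * _ = ((r%:P + 'X) * p) ^+ 2 + (r%:P + 'X) * (r%:P - 'X) * p ^+ 2).
    by rewrite linearD/= addr_ge0.
  by rewrite polyCM; ring.
have Pm p : 0 <= L ((r%:P - 'X) * p ^+ 2).
  apply: scale; rewrite (_ : _ * _ = ((r%:P - 'X) * p) ^+ 2 + (r%:P + 'X) * (r%:P - 'X) * p ^+ 2).
    by rewrite linearD/= addr_ge0.
  by rewrite polyCM; ring.
rewrite -(odd_double_half k) -(odd_double_half l) !exprD -!muln2 !exprM.
set A := r%:P + 'X; set B := r%:P - 'X.
rewrite mulrACA -exprMn.
case: (odd k) (odd l) => [] []; rewrite ?expr0 ?expr1 ?mulr1 ?mul1r; auto.
Qed.

End PositiveBoundedFunctional.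

(* C(k, j) C(n, k) = C(n, j) C(n - j, k - j) reduces this to the binomial
   theorem for (p + q) ^ (n - j). *)
Lemma bernstein_moment gamma p q (n j : nat) : p + q = 1 -> (j <= n)%N ->
  \sum_(k < n.+1) 'C(k, j)%:R / 'C(n, j)%:R *
     ('C(n, k)%:R * moment_functional gamma (p ^+ k * q ^+ (n - k))) =
  moment_functional gamma (p ^+ j).
Proof.
move=> pq1 jn.
have -> : p ^+ j = \sum_(i < (n - j).+1) 'C(n - j, i)%:R *: (p ^+ (j + i) * q ^+ (n - (j + i))).
  rewrite -[LHS]mulr1 -(expr1n _ (n - j)) -pq1 addrC exprDn mulr_sumr.
  apply: eq_bigr => i _.
  by rewrite scaler_nat exprD subnDA mulrnAr mulrCA mulrC -!mulrA mulrC -mulrA [q ^+ _ * _]mulrC.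
rewrite linear_sum/=.
rewrite -(big_mkord xpredT (fun k => 'C(k, j)%:R / 'C(n, j)%:R *
     ('C(n, k)%:R * moment_functional gamma (p ^+ k * q ^+ (n - k))))).
(* The terms with k < j vanish because C(k, j) = 0; the others are reindexed by k = j + i. *)
rewrite (big_cat_nat _ (n := j)) ?leqW//= big_nat big1 ?add0r; last first.
  by move=> i /andP[_ ij]; rewrite bin_small// mul0r mul0r.
rewrite -{1}(add0n j) big_addn subSn// big_mkord; apply: eq_bigr => i _.
rewrite linearZ/= addnC mulrA; congr (_ * _).
have nz : 'C(n, j)%:R != 0 :> R by rewrite pnatr_eq0 -lt0n bin_gt0.
rewrite mulrAC; apply: (canLR (mulfK nz)); rewrite -!natrM.
congr (_%:R).
have ijn : (j + i <= n)%N by have := ltn_ord i; lia.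
have := bin_fact jn; have := bin_fact ijn.
have := bin_fact (leq_addr i j); have := @bin_fact (n - j) i.
rewrite subnDA addKn => /(_ (ltn_ord i)) e1 e2 e3 e4.
have j0 := fact_gt0 j; have i0 := fact_gt0 i; have m0 := fact_gt0 (n - j - i).
apply/eqP; rewrite -(eqn_pmul2r j0) -(eqn_pmul2r i0) -(eqn_pmul2r m0).
apply/eqP.
(* Multiplied by j! i! (n - j - i)!, each side is n!. *)
transitivity (n`!); last by rewrite -e4 -e1; ring.
by rewrite -e3 -e2; ring.
Qed.

(** The ratio is the product of the factors (k - i) / (n - i) for i < j. All of them lie in [0, 1]
    and are within i / (n - i) of k / n, so the errors add up; the induction step uses j^2 + j <= (j
    + 1)^2. *)
Lemma bin_ratio_bound (n k j : nat) : (k <= n)%N -> (j < n)%N ->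
  `|'C(k, j)%:R / 'C(n, j)%:R - (k%:R / n%:R) ^+ j| <= (j ^ 2)%:R / (n - j)%:R :> R.
Proof.
move=> kn; elim: j => [|j IH] jn.
  by rewrite !bin0 expr0 divr1 subrr normr0 divr_ge0.
have {}IH := IH (ltnW jn).
have n0 : 0 < n%:R :> R by rewrite ltr0n; lia.
have nj0 : 0 < (n - j)%:R :> R by rewrite ltr0n; lia.
have nj1 : 0 < (n - j.+1)%:R :> R by rewrite ltr0n; lia.
have binS m : 'C(m, j.+1)%:R = (m - j)%:R * 'C(m, j)%:R / j.+1%:R :> R.
  apply: (mulIf (_ : j.+1%:R != 0 :> R)); first by rewrite pnatr_eq0.
  by rewrite divfK ?pnatr_eq0// -!natrM mulnC mul_bin_left.
have bnz : 'C(n, j)%:R != 0 :> R by rewrite pnatr_eq0 -lt0n bin_gt0 ltnW// ltnW.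
rewrite !binS.
rewrite (_ : _ / _ = 'C(k, j)%:R / 'C(n, j)%:R * ((k - j)%:R / (n - j)%:R)); last first.
  by field; rewrite bnz gt_eqF//= pnatr_eq0.
set u := 'C(k, j)%:R / 'C(n, j)%:R in IH *; set v := _ / (n - j)%:R; set x := k%:R / n%:R in IH *.
have x01 : 0 <= x <= 1.
  by rewrite divr_ge0//= ler_pdivrMr// mul1r ler_nat.
have v01 : 0 <= v <= 1.
  by rewrite divr_ge0//= ler_pdivrMr// mul1r ler_nat leq_sub2r.
have vx : `|v - x| <= j%:R / (n - j)%:R.
  have nE : n%:R = (n - j)%:R + j%:R :> R by rewrite -natrD subnK// ltnW// ltnW.
  have [jk|kj] := leqP j k.
    have kE : k%:R = (k - j)%:R + j%:R :> R by rewrite -natrD subnK.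
    have h : x - v = (j%:R / (n - j)%:R) * ((n - k)%:R / n%:R).
      rewrite /x /v !natrB//; last by rewrite ltnW// ltnW.
      by field; rewrite gt_eqF//= -natrB ?gt_eqF// ltnW// ltnW.
    rewrite distrC h ger0_norm ?mulr_ge0 ?divr_ge0//.
    rewrite ler_piMr ?divr_ge0// ler_pdivrMr// mul1r ler_nat; lia.
  (* For k < j the truncated difference is 0, and k / n itself is small enough. *)
  rewrite /v (_ : (k - j)%N = 0%N) ?mul0r ?sub0r ?normrN; last lia.
  rewrite ger0_norm ?divr_ge0// ler_pM ?invr_ge0 ?ler_nat ?lef_pV2 ?posrE// ?ler_nat ?leq_subr//.
  exact: ltnW.
clearbody u v x.
have -> : u * v - x ^+ j.+1 = (u - x ^+ j) * v + x ^+ j * (v - x) by rewrite exprSr; ring.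
rewrite (le_trans (ler_normD _ _))// !normrM.
have h1 : `|u - x ^+ j| * `|v| <= (j ^ 2)%:R / (n - j)%:R.
  by apply: le_trans IH; rewrite ler_piMr// ger0_norm; lra.
have h2 : `|x ^+ j| * `|v - x| <= j%:R / (n - j)%:R.
  rewrite (le_trans _ vx)// ler_piMl// normrX exprn_ile1// ger0_norm; lra.
rewrite (le_trans (lerD h1 h2))// -mulrDl -natrD.
rewrite ler_pM ?invr_ge0 ?ler_nat ?lef_pV2 ?posrE// ?ler_nat; nia.
Qed.

End MomentFunctional.

(** * Measures with bounded support *)

Section BoundedSupport.
Context {R : realType}.
Implicit Types (mu : {measure set (measurableTypeR R) -> \bar R}).
Implicit Types (gamma : R^nat) (p : {poly R}) (r : R).

Lemma measurable_horner (D : set (measurableTypeR R)) p :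
  measurable_fun D (fun x => p.[x]).
Proof.
apply: measurable_funTS; apply: continuous_measurable_fun; exact: continuous_horner.
Qed.

Lemma represents_poly mu gamma p : represents mu gamma ->
  mu.-integrable [set: measurableTypeR R] (fun t => (p.[t])%:E) /\
  (\int[mu]_t (p.[t])%:E = (moment_functional gamma p)%:E)%E.
Proof.
move=> rep.
have pE : (fun t : measurableTypeR R => (p.[t])%:E) =
    (fun t => \sum_(i < size p) (p`_i)%:E * (t ^+ i)%:E)%E.
  apply/funext => t; rewrite horner_coef -sumEFin.
  by apply: eq_bigr => i _; rewrite EFinM.
have intX (i : 'I_(size p)) : mu.-integrable [set: measurableTypeR R]
    (fun t => (p`_i)%:E * (t ^+ i)%:E)%E.
  by apply: integrableZl => //; exact: (rep i).1.
rewrite pE; split; first by apply: integrable_sum => // i _.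
rewrite integral_sum// /moment_functional -sumEFin; apply: eq_bigr => i _.
by rewrite integralZl//; [rewrite -(rep i).2|exact: (rep i).1].
Qed.

Lemma represents_finite mu gamma : represents mu gamma ->
  mu setT = (gamma 0%N)%:E.
Proof.
move=> rep; rewrite (rep 0%N).2.
under eq_integral do rewrite expr0.
by rewrite integral_cst// mul1e.
Qed.

(** Integrals use bounded support in this null-set form; [supported_in_compact] and
    [compactly_supported_in] relate it to [closed_support]. *)
Definition supported_in mu r := mu [set x | r < `|x|] = 0%E.

Lemma measurable_norm_gt r : measurable ([set x | r < `|x|] : set (measurableTypeR R)).
Proof.
apply: open_measurable.
rewrite (_ : [set _ | _] = Num.Def.normr @^-1` [set y | r < y])//.
by apply: open_comp => [x _|]; [exact: norm_continuous|exact: open_gt].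
Qed.

Lemma measurable_norm_ge r : measurable ([set x | r <= `|x|] : set (measurableTypeR R)).
Proof.
apply: closed_measurable.
rewrite (_ : [set _ | _] = Num.Def.normr @^-1` [set y | r <= y])//.
by apply: preimage_closed => [x _|]; [exact: norm_continuous|exact: closed_ge].
Qed.

(** Markov's inequality for the even power t^(2n). *)
Lemma represents_tail mu gamma r s : represents mu gamma -> 0 < s ->
  forall n, (mu [set x : R | (s <= `|x|)%R] * (s ^+ (2 * n))%:E <= (gamma (2 * n)%N)%:E)%E.
Proof.
move=> rep s0 n.
have mA := measurable_norm_ge s.
rewrite (rep (2 * n)%N).2 muleC -integral_cst//.
have even_pow x : x ^+ (2 * n) = `|x| ^+ (2 * n) :> R.
  by rewrite !exprM real_normK// num_real.
have mX : measurable_fun setT (fun t : measurableTypeR R => (t ^+ (2 * n))%:E).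
  by apply/measurable_EFinP; exact: exprn_measurable.
apply: (@le_trans _ _ (\int[mu]_(x in [set x : R | (s <= `|x|)%R]) (x ^+ (2 * n))%:E)%E).
  apply: ge0_le_integral => //.
  - by move=> x _; rewrite lee_fin exprn_ge0// ltW.
  - exact: measurable_funTS.
  - move=> x /= sx; rewrite lee_fin even_pow lerXn2r ?nnegrE//; exact: ltW.
apply: ge0_subset_integral => // x _.
by rewrite lee_fin even_pow exprn_ge0.
Qed.

(** The mass a of {|x| >= s}, for s > r, satisfies a <= C (r / s)^(2n) for all n and is therefore 0;
    countably many such s exhaust {|x| > r}. *)
Lemma represents_supported mu gamma C r : represents mu gamma -> 0 < r ->
  (forall n, `|gamma n| <= C * r ^+ n) -> supported_in mu r.
Proof.
move=> rep r0 growth; apply/negligibleP; first exact: measurable_norm_gt.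
pose s m := r + (m.+1%:R)^-1 : R.
apply: (@negligibleS _ _ _ _ (\bigcup_m ([set x | s m <= `|x|] : set (measurableTypeR R)))).
  move=> x /= rx; pose m := Num.trunc ((`|x| - r)^-1); exists m => //=.
  have xr0 : 0 < `|x| - r by rewrite subr_gt0.
  rewrite /s -lerBrDl -[leRHS]invrK lef_pV2 ?posrE ?invr_gt0//.
  by apply: ltW; have /andP[] := truncn_itv (ltW (etrans (invr_gt0 _) xr0)).
apply: negligible_bigcup => m.
have rs : r < s m by rewrite ltrDl invr_gt0.
have s0 : 0 < s m by exact: lt_trans rs.
have mA := measurable_norm_ge (s m).
apply/negligibleP => //.
set S := (S in mu S = _).
have fin : mu S \is a fin_num.
  rewrite ge0_fin_numE//; apply: (@le_lt_trans _ _ (mu setT)).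
    by apply: le_measure; rewrite ?inE.
  by rewrite (represents_finite _ _ rep) ltry.
pose a := fine (mu S).
have aE : mu S = a%:E by rewrite fineK.
have a0 : 0 <= a by rewrite -lee_fin -aE.
have tail n : (a%:E * (s m ^+ (2 * n))%:E <= (gamma (2 * n)%N)%:E)%E.
  by rewrite -aE; exact: represents_tail.
rewrite aE; congr EFin; apply: le_anti; rewrite a0 andbT.
pose z := (r / s m) ^+ 2.
have z1 : `|z| < 1.
  rewrite ger0_norm ?sqr_ge0// /z expr_div_n ltr_pdivrMr ?exprn_gt0// mul1r.
  by rewrite ltrXn2r// ltW.
have : (fun n => C * z ^+ n) @ \oo --> C * 0 by apply: cvgMr; exact: cvg_expr.
rewrite mulr0 => /cvgr_to_ge; apply; apply: nearW => n.
have := tail n; rewrite -EFinM lee_fin => /le_trans/(_ (ler_norm _))/le_trans/(_ (growth _)).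
by rewrite /z -exprM expr_div_n mulrA ler_pdivlMr ?exprn_gt0.
Qed.

Lemma supported_in_compact mu r : supported_in mu r -> compactly_supported mu.
Proof.
move=> supp; apply: (subclosed_compact _ (@segment_compact _ (- r) r)).
  rewrite (_ : closed_support mu = ~` \bigcup_(U in [set U : set R | open U /\ mu U = 0%E]) U).
    by apply: open_closedC; apply: bigcup_open => U [].
  apply/seteqP; split=> [x sx [U [oU U0] Ux]|x Nx U oU Ux].
    by have := sx U oU Ux; rewrite U0 ltxx.
  rewrite lt_neqAle measure_ge0 andbT; apply/eqP => U0.
  by apply: Nx; exists U.
move=> x sx /=; rewrite in_itv/= -ler_norml leNgt; apply/negP => rx.
have oU : open [set x : R | r < `|x|].
  rewrite (_ : [set _ | _] = Num.Def.normr @^-1` [set y | r < y])//.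
  by apply: open_comp => [y _|]; [exact: norm_continuous|exact: open_gt].
by have := sx _ oU rx; rewrite [X in (_ < X)%E]supp ltxx.
Qed.

(** A Lindelof argument: a point outside the support has an open null neighbourhood, hence lies in a
    null interval with rational endpoints, and there are countably many of these. *)
Lemma compactly_supported_in mu : compactly_supported mu ->
  exists2 r, 0 < r & supported_in mu r.
Proof.
move=> /compact_bounded[M [_ bM]].
(* The support is bounded by every number greater than M; this one is also positive. *)
pose r := `|M| + 1; have r0 : 0 < r by rewrite ltr_wpDl.
exists r => //; apply/negligibleP; first exact: measurable_norm_gt.
pose J (pq : rat * rat) : set (measurableTypeR R) := `](ratr pq.1), (ratr pq.2)[%classic.
(* [F] runs through the null rational intervals, all other codes giving the empty set. *)
pose F n : set (measurableTypeR R) := if unpickle n is Some pq then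
  (if mu (J pq) == 0%E then J pq else set0) else set0.
apply: (@negligibleS _ _ _ _ (\bigcup_n F n)); last first.
  apply: negligible_bigcup => n; rewrite /F.
  case: unpickle => [pq|]; last exact: negligible_set0.
  case: eqP => [J0|_]; last exact: negligible_set0.
  by apply/negligibleP => //; exact: measurable_itv.
move=> x /= rx.
have : ~ closed_support mu x.
  move=> sx; have := bM r; rewrite /r (le_lt_trans (ler_norm M)) ?ltrDl// => /(_ isT x sx)/=.
  by rewrite leNgt rx.
move=> /existsNP[U /not_implyP[oU /not_implyP[Ux U0]]].
have {}U0 : mu U = 0%E.
  by apply/eqP; rewrite eq_le measure_ge0 andbT leNgt; exact/negP.
have : nbhs x U by exact: open_nbhs_nbhs.
move=> /nbhs_ballP[e /= e0 eU].
have [p] : exists p : rat, ratr p \in `]x - e, x[ by apply: rat_in_itvoo; lra.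
have [q] : exists q : rat, ratr q \in `]x, x + e[ by apply: rat_in_itvoo; lra.
rewrite !in_itv/= => /andP[xq qe] /andP[pe px].
have JU : J (p, q) `<=` U.
  move=> y; rewrite /J/= in_itv/= => /andP[py yq]; apply: eU => /=.
  rewrite /ball/= ltr_distlC; apply/andP; split; first exact: lt_trans py.
  exact: lt_trans qe.
have mI : measurable (J (p, q)) by exact: measurable_itv.
have J0 : mu (J (p, q)) = 0%E.
  by apply/eqP; rewrite -measure_le0 -U0 le_measure ?inE//; exact: open_measurable.
have [n nE] : exists n, unpickle n = Some (p, q) by exists (pickle (p, q)); exact: pickleK.
exists n; first exact: I.
rewrite /F nE J0 eqxx /J/=.
by rewrite in_itv/= px xq.
Qed.

Lemma supported_integrable mu r K (f : R -> R) : supported_in mu r ->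
  (mu setT < +oo)%E -> measurable_fun [set: measurableTypeR R] f ->
  (forall x, `|x| <= r -> `|f x| <= K) ->
  mu.-integrable [set: measurableTypeR R] (EFin \o f).
Proof.
move=> supp fin mf fK.
apply/(negligible_integrable (measurable_norm_gt r) measurableT _ supp).
  exact/measurable_EFinP.
have mD : measurable ([set: measurableTypeR R] `\` [set x | r < `|x|]).
  by apply: measurableD => //; exact: measurable_norm_gt.
apply: measurable_bounded_integrable => //.
- by rewrite (le_lt_trans _ fin)// le_measure ?inE.
- exact: measurable_funTS.
- exists K; split; first exact: num_real.
  move=> M KM x [_ /= /negP]; rewrite -leNgt => xr.
  by rewrite (le_trans (fK _ xr))// ltW.
Qed.

Lemma horner_bound p r x : `|x| <= r ->
  `|p.[x]| <= \sum_(i < size p) `|p`_i| * r ^+ i.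
Proof.
move=> xr; rewrite horner_coef (le_trans (ler_norm_sum _ _ _))//.
apply: ler_sum => i _; rewrite normrM normrX ler_wpM2l//.
by rewrite lerXn2r ?nnegrE// (le_trans _ xr).
Qed.

Lemma supported_integrable_poly mu r p : supported_in mu r ->
  (mu setT < +oo)%E ->
  mu.-integrable [set: measurableTypeR R] (fun x => (p.[x])%:E).
Proof.
move=> supp fin; apply: supported_integrable supp fin _ _; last first.
  by move=> x xr; exact: horner_bound xr.
exact: measurable_horner.
Qed.

Lemma supported_represents mu r : supported_in mu r -> (mu setT < +oo)%E ->
  represents mu (fun n => fine (\int[mu]_t (t ^+ n)%:E)%E).
Proof.
move=> supp fin n.
have intX : mu.-integrable [set: measurableTypeR R] (fun t => (t ^+ n)%:E).
  by under eq_fun do rewrite -hornerXn; exact: supported_integrable_poly supp fin.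
by split => //; rewrite fineK//; exact: integrable_fin_num.
Qed.

End BoundedSupport.

(** * Determinacy *)

Section BoundedMomentUniqueness.
Context {R : realType}.
Implicit Types (mu : {measure set (measurableTypeR R) -> \bar R}).
Implicit Types (gamma : R^nat) (p : {poly R}) (r s c : R).

Lemma bernoulli_ge u n : 0 <= u <= 1 -> 1 - n%:R * u <= (1 - u) ^+ n :> R.
Proof.
move=> /andP[u0 u1]; elim: n => [|n IH]; first by rewrite mul0r subr0.
rewrite exprSr (le_trans _ (ler_wpM2r _ IH)) ?subr_ge0//.
rewrite (_ : (1 - _) * _ = 1 - (n%:R + 1) * u + n%:R * u ^+ 2); last by ring.
by rewrite natr1 lerDl mulr_ge0// sqr_ge0.
Qed.

(** Since 1 + n u <= (1 + u)^n, the product is at most (1 - u^2)^n. *)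
Lemma bernoulli_inv u n : 0 <= u <= 1 -> (1 - u) ^+ n * (1 + n%:R * u) <= 1 :> R.
Proof.
move=> /andP[u0 u1].
have h : 1 + n%:R * u <= (1 + u) ^+ n.
  elim: n => [|n IH]; first by rewrite mul0r addr0.
  rewrite exprSr (le_trans _ (ler_wpM2r _ IH)) ?addr_ge0//.
  rewrite (_ : (1 + _ * u) * _ = 1 + (n%:R + 1) * u + n%:R * u ^+ 2); last by ring.
  by rewrite natr1 lerDl mulr_ge0// sqr_ge0.
rewrite (le_trans (ler_wpM2l _ h)) ?exprn_ge0 ?subr_ge0// -exprMn.
rewrite (_ : (1 - u) * (1 + u) = 1 - u ^+ 2); last by ring.
by rewrite exprn_ile1 ?subr_ge0 ?exprn_ile1// gerBl sqr_ge0.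
Qed.

(** With y the square root of z, [bernoulli_inv] at u = 1 - y bounds n y^n, and the remaining factor
    y^n tends to 0. *)
Lemma cvg_natr_expr z : 0 <= z -> z < 1 -> (fun n => n%:R * z ^+ n) @ \oo --> (0 : R).
Proof.
move=> z0 z1; have [->|zn0] := eqVneq z 0.
  apply: (cvg_near_cst) => /=; near=> n.
  by rewrite expr0n gtn_eqF ?mulr0//; near: n; exact: nbhs_infty_gt.
have zp : 0 < z by rewrite lt_neqAle eq_sym zn0.
pose y := Num.sqrt z.
have y0 : 0 < y by rewrite sqrtr_gt0.
have y1 : y < 1 by rewrite -sqrtr1 ltr_sqrt.
have zE : z = y ^+ 2 by rewrite sqr_sqrtr.
have bnd n : n%:R * y ^+ n <= (1 - y)^-1.
  have u01 : 0 <= 1 - y <= 1 by lra.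
  have hb := bernoulli_inv (1 - y) n u01; rewrite subKr in hb.
  rewrite -[leRHS]mul1r ler_pdivlMr; last lra.
  rewrite mulrAC mulrC (le_trans _ hb)// ler_wpM2l ?exprn_ge0 ?lerDr//.
  exact: ltW.
apply: (@squeeze_cvgr _ _ _ _ (cst 0) (fun n => (1 - y)^-1 * y ^+ n)).
- apply: nearW => n; rewrite mulr_ge0 ?exprn_ge0//=.
  by rewrite zE exprAC expr2 mulrA ler_wpM2r ?exprn_ge0// ltW.
- exact: cvg_cst.
- rewrite -[X in _ --> X](mulr0 (1 - y)^-1); apply: cvgMr; apply: cvg_expr.
  by rewrite ger0_norm// ltW.
Unshelve. all: by end_near. Qed.

(* The thresholds N_n ~ c^-n / n make N_n s^n tend to 0 for s <= c and to
   infinity for s > c, so (1 - s^n)^N_n separates the two cases on [0, 1]. *)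
Lemma poly_ray_approx r c : 0 < r -> exists P : nat -> {poly R},
  (forall n x, `|x| <= r -> 0 <= (P n).[x] <= 1) /\
  (forall x, `|x| <= r -> (fun n => (P n).[x]) @ \oo --> (\1_(`]c, +oo[%classic) x : R)).
Proof.
(* This b makes the affine map s send [-r, r] into [0, 1] and c strictly inside ]0, 1[. *)
move=> r0; pose b := r + `|c| + 1.
have b0 : 0 < b by rewrite /b ltr_wpDl// addr_ge0// ltW.
pose s x := (x + b) / (2 * b).
have s01 x : `|x| <= r -> 0 <= s x <= 1.
  rewrite ler_norml => /andP[xr rx]; have := normr_ge0 c => c0.
  have bE : b = r + `|c| + 1 by [].
  rewrite /s divr_ge0 ?mulr_ge0 ?(ltW b0)//=; last lra.
  by rewrite ler_pdivrMr ?mulr_gt0//; lra.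
have sc01 : 0 < s c < 1.
  have bE : b = r + `|c| + 1 by [].
  have := lexx `|c|; rewrite ler_norml => /andP[c1 c2].
  rewrite /s divr_gt0 ?mulr_gt0//=; last lra.
  by rewrite ltr_pdivrMr ?mulr_gt0//; lra.
have s_mono x y : x <= y -> s x <= s y.
  by move=> xy; rewrite /s ler_wpM2r ?lerD2r// invr_ge0 mulr_ge0// ltW.
have s_smono x y : x < y -> s x < s y.
  by move=> xy; rewrite /s ltr_pM2r ?ltrD2r// invr_gt0 mulr_gt0.
move: sc01 => /andP[sc0 sc1].
pose w n := (s c) ^- n.+1 / n.+1%:R.
have w0 n : 0 <= w n by rewrite divr_ge0// invr_ge0 exprn_ge0// ltW.
(* Rounding so that w <= N <= w + 1: the lower bound serves x > c, the upper one x <= c. *)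
pose N n := (Num.trunc (w n)).+1.
have wN n : w n <= (N n)%:R by rewrite ltW//; have /andP[] := truncn_itv (w0 n).
have Nw n : (N n)%:R <= w n + 1.
  by rewrite /N -natr1 lerD2r; have /andP[] := truncn_itv (w0 n).
pose P n : {poly R} := 1 - (1 - ((2 * b)^-1 *: ('X + b%:P)) ^+ n.+1) ^+ N n.
have PE n x : (P n).[x] = 1 - (1 - s x ^+ n.+1) ^+ N n.
  have -> : s x = (2 * b)^-1 * (x + b) by rewrite mulrC.
  by rewrite /P !(hornerE, horner_exp).
have u01 n x : `|x| <= r -> 0 <= s x ^+ n.+1 <= 1.
  by move=> /s01/andP[s0 s1]; rewrite exprn_ge0//= exprn_ile1.
exists P; split => [n x /(u01 n)/andP[u0 u1]|x xr].
  by rewrite PE subr_ge0 exprn_ile1 ?subr_ge0//= ?gerBl// exprn_ge0// subr_ge0.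
rewrite indicE; have [cx|xc] := ltP c x.
  rewrite mem_set/=; last by rewrite in_itv/= cx.
  have sx0 : 0 < s x by exact: lt_trans (s_smono _ _ cx).
  pose z := s c / s x.
  have z0 : 0 <= z by rewrite divr_ge0// ltW.
  have z1 : z < 1 by rewrite ltr_pdivrMr// mul1r s_smono.
  (* With u = (s x)^(n+1), [bernoulli_inv] gives (1 - u)^N <= 1 / (w u), which is (n + 1)
     z^(n+1). *)
  apply: (@squeeze_cvgr _ _ _ _ (fun n => 1 - n.+1%:R * z ^+ n.+1) (cst 1)); last 2 first.
  - rewrite -[X in _ --> X]subr0; apply: cvgB; first exact: cvg_cst.
    by have := cvg_natr_expr z z0 z1; rewrite -cvg_shiftS.
  - exact: cvg_cst.
  apply: nearW => n; rewrite PE; apply/andP; split; last first.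
    by rewrite gerBl exprn_ge0// subr_ge0; have /andP[] := u01 n x xr.
  rewrite lerB//; have := bernoulli_inv _ (N n) (u01 n x xr).
  set v := (1 - _) ^+ _ => hv.
  have v0 : 0 <= v by rewrite exprn_ge0// subr_ge0; have /andP[] := u01 n x xr.
  have t0 : 0 < w n * s x ^+ n.+1 by rewrite mulr_gt0 ?exprn_gt0// divr_gt0// invr_gt0 exprn_gt0.
  rewrite (_ : n.+1%:R * z ^+ n.+1 = (w n * s x ^+ n.+1)^-1); last first.
    rewrite /w /z expr_div_n; field.
    by rewrite addrC natr1 pnatr_eq0 !expf_neq0 ?gt_eqF.
  rewrite -[leRHS]mul1r ler_pdivlMr// (le_trans _ hv)// ler_wpM2l//.
  by rewrite (@le_trans _ _ ((N n)%:R * s x ^+ n.+1)) ?lerDr// ler_wpM2r// exprn_ge0// ltW.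
rewrite memNset/=; last by rewrite in_itv/= andbT; apply/negP; rewrite -leNgt.
(* Here 1 - (1 - u)^N <= N u <= (w + 1) (s c)^(n+1), which is the upper sequence. *)
apply: (@squeeze_cvgr _ _ _ _ (cst 0) (fun n => n.+1%:R^-1 + s c ^+ n.+1)); last 2 first.
- exact: cvg_cst.
- rewrite -[X in _ --> X]addr0; apply: cvgD; first exact: cvg_harmonic.
  rewrite (cvg_shiftS (fun n => s c ^+ n)); apply: cvg_expr.
  by rewrite ger0_norm// ltW.
apply: nearW => n; rewrite PE; have /andP[u0 u1] := u01 n x xr.
rewrite subr_ge0 exprn_ile1 ?subr_ge0 ?gerBl//=.
rewrite lerBlDr -lerBlDl (le_trans _ (bernoulli_ge _ (N n) (u01 n x xr)))// lerB//.
rewrite (@le_trans _ _ ((w n + 1) * s c ^+ n.+1))//.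
  rewrite ler_pM//; have /andP[s0 s1] := s01 x xr.
  by rewrite lerXn2r ?nnegrE ?s_mono// ltW.
rewrite mulrDl mul1r /w mulrAC mulVf ?mul1r//.
by rewrite expf_neq0// gt_eqF.
Qed.

(** Dominated convergence with bound 1. It is applied on [-r, r] because the polynomials are
    uncontrolled outside, where mu has no mass. *)
Lemma bounded_moments_ray mu gamma r c (P : nat -> {poly R}) :
  supported_in mu r -> represents mu gamma ->
  (forall n x, `|x| <= r -> 0 <= (P n).[x] <= 1) ->
  (forall x, `|x| <= r -> (fun n => (P n).[x]) @ \oo --> (\1_(`]c, +oo[%classic) x : R)) ->
  (fun n => (moment_functional gamma (P n))%:E) @ \oo --> mu `]c, +oo[%classic.
Proof.
move=> supp rep P01 Pcvg.
have fin : (mu setT < +oo)%E by rewrite (represents_finite _ _ rep) ltry.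
have mN := measurable_norm_gt r.
set Nr : set (measurableTypeR R) := [set x | r < `|x|] in mN.
pose D : set (measurableTypeR R) := setT `\` Nr.
have mD : measurable D by exact: measurableD.
have Dr x : D x -> `|x| <= r by move=> [_ /negP]; rewrite -leNgt.
have mA : measurable (`]c, +oo[%classic : set (measurableTypeR R)) by exact: measurable_itv.
have finD : (mu D < +oo)%E by rewrite (le_lt_trans _ fin)// le_measure ?inE.
have [] := @dominated_convergence _ _ _ mu D mD (fun n x => ((P n).[x])%:E)
  (fun x => (\1_(`]c, +oo[%classic) x)%:E) (cst 1%E).
- by move=> n; apply/measurable_EFinP; exact: measurable_horner.
- by apply/measurable_EFinP; exact: measurable_indic.
- apply: aeW => x Dx; apply/cvg_EFin; first by apply: nearW.
  exact: Pcvg (Dr _ Dx).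
- by apply/integrableP; split => //; rewrite /= normr1 integral_cst// mul1e.
- apply: aeW => x n Dx; rewrite /= lee_fin; have /andP[? ?] := P01 n x (Dr _ Dx).
  by rewrite ger0_norm.
move=> _ _ /=.
have -> : (\int[mu]_(x in D) (\1_(`]c, +oo[%classic) x)%:E = mu `]c, +oo[%classic)%E.
  rewrite /D -negligible_integral//; first by rewrite integral_indic// setIT.
  apply: supported_integrable supp fin _ _; first exact: measurable_indic.
  by move=> x _; rewrite indicE; case: (_ \in _); rewrite ?normr1 ?normr0.
rewrite (_ : (fun n => (moment_functional gamma (P n))%:E) =
  (fun n => \int[mu]_(x in D) ((P n).[x])%:E)%E)//; apply/funext => n.
have [intP PE] := represents_poly _ _ (P n) rep.
by rewrite -PE; exact: negligible_integral mN measurableT intP supp.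
Qed.

(** Both measures of a ray are limits of the same numbers, which depend on gamma and r only; the
    rays are a generating family stable under intersection. *)
Lemma bounded_moments_unique mu1 mu2 gamma r : 0 < r ->
  supported_in mu1 r -> supported_in mu2 r ->
  represents mu1 gamma -> represents mu2 gamma ->
  forall A : set (measurableTypeR R), measurable A -> mu1 A = mu2 A.
Proof.
move=> r0 supp1 supp2 rep1 rep2.
apply: (@measure_unique _ R (measurableTypeR R) (@RGenOInfty.G R)
  (fun n => `](- n%:R), +oo[%classic)).
- exact: RGenOInfty.measurableE.
- move=> _ _ [x ->] [y ->]; exists (Num.max x y).
  apply/seteqP; split => z /=; rewrite !in_itv/= !andbT gt_max.
    by move=> [-> ->].
  by move=> /andP[].
- by move=> n; exists (- n%:R).
- apply/seteqP; split => // x _; exists (Num.bound `|x|) => //=.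
  rewrite in_itv/= andbT ltrNl (le_lt_trans (ler_norm _))// normrN.
  exact: archi_boundP.
- move=> _ [c ->]; have [P [P01 Pcvg]] := poly_ray_approx _ c r0.
  have h1 := bounded_moments_ray _ _ _ _ _ supp1 rep1 P01 Pcvg.
  have h2 := bounded_moments_ray _ _ _ _ _ supp2 rep2 P01 Pcvg.
  by rewrite -(cvg_lim (@ereal_hausdorff R) h1) -(cvg_lim (@ereal_hausdorff R) h2).
- move=> k; apply: (@le_lt_trans _ _ (mu1 [set: measurableTypeR R])).
    by apply: le_measure; rewrite ?inE//; exact: measurable_itv.
  by rewrite (represents_finite _ _ rep1) ltry.
Qed.

End BoundedMomentUniqueness.

(** * Measures with density *)

Section Density.
Local Open Scope ereal_scope.
Context d (T : measurableType d) (R : realType).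
Variables (mu : {measure set T -> \bar R}) (g : T -> R).
Hypotheses (mg : measurable_fun setT g) (g0 : forall x, (0 <= g x)%R).

(** The two proofs are arguments so that the term itself carries what the measure instance below
    needs. *)
Definition density_measure of measurable_fun setT g & (forall x, (0 <= g x)%R) :=
  fun A : set T => \int[mu]_(x in A) (g x)%:E.

Local Notation dens := (density_measure mg g0).

Let dens_set0 : dens set0 = 0.
Proof. by rewrite /density_measure integral_set0. Qed.

Let dens_ge0 A : 0 <= dens A.
Proof. by apply: integral_ge0 => x _; rewrite lee_fin. Qed.

Let dens_sigma_additive : semi_sigma_additive dens.
Proof.
move=> F mF tF mUF; rewrite /density_measure ge0_integral_bigcup//; last 2 first.
- by apply: measurable_funTS; exact/measurable_EFinP.
- by move=> x _; rewrite lee_fin.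
apply: is_cvg_ereal_nneg_natsum_cond => n _ _.
by apply: integral_ge0 => x _; rewrite lee_fin.
Qed.

HB.instance Definition _ := isMeasure.Build _ _ _ dens
  dens_set0 dens_ge0 dens_sigma_additive.

Import HBNNSimple.

(** Both sides equal the sum over the values r of h of r times the integral of g over the fibre of
    r. *)
Lemma integral_density_nnsfun (h : {nnsfun T >-> R}) :
  \int[dens]_x (h x)%:E = \int[mu]_x (h x * g x)%:E.
Proof.
have hE x : (h x * g x)%:E =
    \sum_(r \in range h) r%:E * ((EFin \o g) \_ (h @^-1` [set r])) x.
  rewrite {1}fimfunE EFinM -fsumEFin// ge0_mule_fsuml => [|r]; last first.
    exact: nnfun_muleindic_ge0.
  apply: eq_fsbigr => r _; rewrite EFinM -muleA patchE indicE.
  by case: (x \in _); rewrite ?mul1e ?mul0e.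
have mgr r : measurable_fun setT ((EFin \o g) \_ (h @^-1` [set r])).
  apply/(measurable_restrictT _ _).1 => //.
  by apply: measurable_funTS; exact/measurable_EFinP.
have gr0 r x : 0 <= ((EFin \o g) \_ (h @^-1` [set r])) x.
  by rewrite patchE; case: ifP => // _; rewrite lee_fin.
under [RHS]eq_integral do rewrite hE.
rewrite integral_nnsfun// patch_setT sintegralE ge0_integral_fsum//; last 2 first.
- by move=> r; apply: emeasurable_funM.
- move=> r x _; have [r0|r0] := leP 0%R r; first by rewrite mule_ge0.
  by rewrite preimage_nnfun0// patch_set0 mule0.
(* A negative r has an empty fibre, so its terms vanish on both sides. *)
apply: eq_fsbigr => r _; have [r0|r0] := leP 0%R r; last first.
  rewrite preimage_nnfun0// measure0 mule0 integral0_eq// => x _.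
  by rewrite patch_set0 mule0.
by rewrite ge0_integralZl// -integral_mkcond.
Qed.

(** Monotone convergence on both sides, along simple functions increasing to f on E. *)
Lemma ge0_integral_density (f : T -> \bar R) (E : set T) :
    (forall x, 0 <= f x) -> measurable E -> measurable_fun E f ->
  \int[dens]_(x in E) f x = \int[mu]_(x in E) (f x * (g x)%:E).
Proof.
move=> f0 mE mf; rewrite [LHS]integral_mkcond [RHS]integral_mkcond.
have mfE : measurable_fun setT (f \_ E) by exact/(measurable_restrictT _ _).1.
have fE0 x : 0 <= (f \_ E) x by rewrite patchE; case: ifP.
pose h := nnsfun_approx measurableT mfE.
have hf x : (fun n => (h n x)%:E) @ \oo --> (f \_ E) x by exact: cvg_nnsfun_approx.
have ndh x : {homo (fun n => h n x) : n m / (n <= m)%N >-> (n <= m)%R}.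
  by move=> n m nm; exact/lefP/nd_nnsfun_approx.
have mg' := (measurable_EFinP _ _).2 mg.
have l1 : \int[dens]_x (h n x)%:E @[n --> \oo] --> \int[dens]_x (f \_ E) x.
  rewrite (_ : (f \_ E) = fun x => limn (fun n => (h n x)%:E)).
    apply: cvg_monotone_convergence => //.
    - by move=> n; exact/measurable_EFinP.
    - by move=> n x _; rewrite lee_fin.
    - by move=> x _ n m nm; rewrite lee_fin ndh.
  by apply/funext => x; apply/esym/cvg_lim.
have l2 : \int[mu]_x (h n x * g x)%:E @[n --> \oo] --> \int[mu]_x ((f \_ E) x * (g x)%:E).
  rewrite (_ : (fun x => _ * _) = fun x => limn (fun n => (h n x * g x)%:E)).
    apply: cvg_monotone_convergence => //.
    - by move=> n; apply/measurable_EFinP; exact: measurable_funM.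
    - by move=> n x _; rewrite lee_fin mulr_ge0.
    - by move=> x _ n m nm; rewrite lee_fin ler_wpM2r// ndh.
  apply/funext => x; apply/esym/cvg_lim => //; under eq_fun do rewrite EFinM.
  exact: cvgeZr.
transitivity (\int[mu]_x ((f \_ E) x * (g x)%:E)).
  rewrite -[LHS](cvg_lim _ l1)// -[RHS](cvg_lim _ l2)//.
  by under eq_fun do rewrite integral_density_nnsfun.
by apply: eq_integral => x _; rewrite !patchE; case: ifP; rewrite ?mul0e.
Qed.

Lemma integrable_density (f : T -> R) : measurable_fun setT f ->
  mu.-integrable setT (fun x => (f x * g x)%:E) ->
  dens.-integrable setT (EFin \o f).
Proof.
move=> mf /integrableP[_ fin]; apply/integrableP; split; first exact/measurable_EFinP.
rewrite ge0_integral_density//; last by do 2 apply: measurableT_comp => //.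
apply: le_lt_trans fin; rewrite le_eqVlt; apply/predU1l.
by apply: eq_integral => x _ /=; rewrite normrM (ger0_norm (g0 x)).
Qed.

(** Multiplication by g >= 0 commutes with positive and negative parts, so the nonnegative case
    applies to each. *)
Lemma integral_density (f : T -> R) : measurable_fun setT f ->
  \int[dens]_x (f x)%:E = \int[mu]_x (f x * g x)%:E.
Proof.
move=> mf; rewrite (integralE dens) (integralE mu).
have mfE : measurable_fun setT (EFin \o f) by exact/measurable_EFinP.
rewrite !ge0_integral_density//; last 2 first.
- exact: measurable_funeneg.
- exact: measurable_funepos.
by congr (_ - _); apply: eq_integral => x _;
  rewrite !(funeposE, funenegE) -?EFinN -!EFin_max -EFinM maxr_pMl// mul0r ?mulNr.
Qed.

End Density.

(** * Limits of discrete measures *)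

Section MonotoneIntegral.
Context {R : realType}.
Local Notation leb := (@lebesgue_measure R).
Implicit Types f : R -> R.

Lemma lebesgue_measure_itvoc (a b : R) : a <= b ->
  leb `]a, b]%classic = (b - a)%:E.
Proof.
rewrite lebesgue_measure_itv/= lte_fin le_eqVlt => /predU1P[->|->]; last by rewrite EFinB.
by rewrite ltxx subrr.
Qed.

Lemma lebesgue_measure_itvoc_fin (a b : R) : (leb `]a, b]%classic < +oo)%E.
Proof.
by rewrite lebesgue_measure_itv/= lte_fin; case: ifP => _; rewrite -?EFinB ltry.
Qed.

Lemma nondecreasing_integrable f a b : nondecreasing_fun f ->
  (forall u, 0 <= f u <= 1) -> leb.-integrable `]a, b]%classic (EFin \o f).
Proof.
move=> ndf f01; apply: measurable_bounded_integrable => //.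
- exact: lebesgue_measure_itvoc_fin.
- exact: nondecreasing_measurable.
- exists 1; split; first exact: num_real.
  move=> M M1 u _ /=; have /andP[f0 f1] := f01 u.
  by rewrite ger0_norm// (le_trans f1)// ltW.
Qed.

Lemma Rintegral_itvoc_cst (a b c : R) : a <= b ->
  \int[leb]_(u in `]a, b]) c = c * (b - a).
Proof. by move=> ab; rewrite Rintegral_cst//= lebesgue_measure_itvoc. Qed.

Lemma Rintegral_split f (a : nat -> R) N : nondecreasing_fun f ->
  (forall u, 0 <= f u <= 1) -> (forall i, a i <= a i.+1) ->
  \int[leb]_(u in `]a 0%N, a N]) f u =
  \sum_(i < N) \int[leb]_(u in `]a i, a i.+1]) f u.
Proof.
move=> ndf f01 aS; elim: N => [|N IH].
  by rewrite big_ord0 set_itv_ge ?Rintegral_set0// bnd_simp ltxx.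
have a0N n : a 0%N <= a n by elim: n => [//|n /le_trans]; apply.
rewrite big_ord_recr/= -IH.
have := @Rintegral_itvB R f (BRight (a 0%N)) (BRight (a N.+1)) (a N)
  (nondecreasing_integrable _ _ _ ndf f01).
by rewrite !bnd_simp a0N aS => /(_ isT isT) <-; rewrite addrC subrK.
Qed.

(** On each cell the error of the left sum is at most h times the increment of f, and the increments
    telescope to at most 1. The bound does not depend on f, which lets limits of functions pass
    through the integral. *)
Lemma riemann_sum_bound f (M : R) N : nondecreasing_fun f ->
  (forall u, 0 <= f u <= 1) -> 0 <= M -> (0 < N)%N ->
  `|\int[leb]_(u in `]0, M]) f u - \sum_(i < N) M / N%:R * f (i%:R * (M / N%:R))|
    <= M / N%:R.
Proof.
move=> ndf f01 M0 N0; set h := M / N%:R.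
have h0 : 0 <= h by rewrite divr_ge0.
pose a i := i%:R * h.
have aS i : a i <= a i.+1 by rewrite /a -natr1 mulrDl mul1r lerDl.
have aSB i : a i.+1 - a i = h by rewrite /a -natr1 mulrDl mul1r addrC addKr.
have a0 : a 0%N = 0 by rewrite /a mul0r.
have aN : a N = M by rewrite /a /h mulrC divfK// pnatr_eq0 -lt0n.
have -> : \int[leb]_(u in `]0, M]) f u = \sum_(i < N) \int[leb]_(u in `]a i, a i.+1]) f u.
  by rewrite -Rintegral_split// a0 aN.
have cint c i : leb.-integrable `](a i), (a i.+1)]%classic (EFin \o cst c).
  apply: measurable_bounded_integrable => //.
    exact: lebesgue_measure_itvoc_fin.
  exists `|c|; split; first exact: num_real.
  by move=> K cK u _ /=; exact: ltW.
have lo i : h * f (a i) <= \int[leb]_(u in `]a i, a i.+1]) f u.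
  rewrite -(aSB i) mulrC -Rintegral_itvoc_cst//; apply: le_Rintegral => //.
  - exact: cint.
  - exact: nondecreasing_integrable.
  - by move=> u /=; rewrite in_itv/= => /andP[au _]; apply: ndf; exact: ltW.
have hi i : \int[leb]_(u in `]a i, a i.+1]) f u <= h * f (a i.+1).
  rewrite -(aSB i) mulrC -Rintegral_itvoc_cst//; apply: le_Rintegral => //.
  - exact: nondecreasing_integrable.
  - exact: cint.
  - by move=> u /=; rewrite in_itv/= => /andP[_ ua]; apply: ndf.
rewrite -sumrB ger0_norm; last by apply: sumr_ge0 => i _; rewrite subr_ge0 lo.
apply: (@le_trans _ _ (\sum_(i < N) (h * f (a i.+1) - h * f (a i)))).
  by apply: ler_sum => i _; rewrite lerB// hi.
rewrite -(big_mkord xpredT (fun i => h * f (a i.+1) - h * f (a i))).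
rewrite (telescope_sumr (fun i => h * f (a i)))// -mulrBr ler_piMr//.
have /andP[_ fN1] := f01 (a N); have /andP[f00 _] := f01 (a 0%N); lra.
Qed.

(* The left-continuous quantile function of the sum over k <= n of w_k times the
   Dirac mass at k/n. *)
Definition quantile (w : nat -> R) (n : nat) (u : R) : R :=
  (\sum_(k < n) (\sum_(i < k.+1) w i < u)%R)%:R / n%:R.

Lemma quantile_nondecreasing (w : nat -> R) n : nondecreasing_fun (quantile w n).
Proof.
move=> u v uv; rewrite /quantile ler_wpM2r ?invr_ge0// ler_nat leq_sum// => k _.
by case: ltP => // wu; rewrite (lt_le_trans wu uv).
Qed.

Lemma quantile01 (w : nat -> R) n u : 0 <= quantile w n u <= 1.
Proof.
(* At n = 0 the quotient is 0 / 0 = 0. *)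
rewrite /quantile divr_ge0//=; case: n => [|n]; first by rewrite big_ord0 mul0r.
rewrite ler_pdivrMr ?ltr0n// mul1r ler_nat -[leqRHS]card_ord -sum1_card.
by apply: leq_sum => i _; case: (_ < _)%R.
Qed.

Lemma exprn_nondecreasing f j : nondecreasing_fun f -> (forall u, 0 <= f u <= 1) ->
  nondecreasing_fun (fun u => f u ^+ j) /\ forall u, 0 <= f u ^+ j <= 1.
Proof.
move=> ndf f01; split => [u v uv|u]; last first.
  by have /andP[f0 f1] := f01 u; rewrite exprn_ge0//= exprn_ile1.
have /andP[fu0 _] := f01 u; have /andP[fv0 _] := f01 v.
by rewrite lerXn2r ?nnegrE//; exact: ndf.
Qed.

(** On the k-th cell between consecutive partial sums, of length w_k, exactly k of the counted
    partial sums lie strictly below u, so the quantile is the constant k / n there. *)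
Lemma quantile_moment (w : nat -> R) n j : (forall k, 0 <= w k) ->
  \int[leb]_(u in `]0, \sum_(k < n.+1) w k]) quantile w n u ^+ j =
  \sum_(k < n.+1) w k * (k%:R / n%:R) ^+ j.
Proof.
move=> w0; pose a k := \sum_(i < k) w i.
have aS i : a i <= a i.+1 by rewrite /a big_ord_recr/= lerDl.
have a_mono i k : (i <= k)%N -> a i <= a k.
  by move=> /subnK <-; elim: (k - i)%N => [//|m /le_trans]; apply; rewrite addSn.
have [ndj j01] := exprn_nondecreasing _ j (quantile_nondecreasing w n) (quantile01 w n).
have -> : \int[leb]_(u in `]0, \sum_(k < n.+1) w k]) quantile w n u ^+ j =
  \sum_(k < n.+1) \int[leb]_(u in `]a k, a k.+1]) quantile w n u ^+ j.
  by rewrite -Rintegral_split// /a big_ord0.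
apply: eq_bigr => k _.
have -> : w k = a k.+1 - a k by rewrite /a big_ord_recr/= addrAC subrr add0r.
rewrite mulrC -Rintegral_itvoc_cst//; apply: eq_Rintegral => u.
rewrite inE/= in_itv/= => /andP[au ua].
congr ((_%:R / _) ^+ _).
transitivity (\sum_(i < n) (i < k))%N.
  apply: eq_bigr => i _; congr nat_of_bool; rewrite -/(a i.+1).
  have [ik|ki] := ltnP i k; first by rewrite (le_lt_trans _ au)// a_mono.
  by apply/negbTE; rewrite -leNgt (le_trans ua)// a_mono.
have kn : (k <= n)%N by rewrite -ltnS.
transitivity (\sum_(i < k) 1)%N; last by rewrite sum1_card card_ord.
rewrite (big_ord_widen n (fun=> 1%N) kn) [RHS]big_mkcond; apply: eq_bigr => i _.
by case: (i < k)%N.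
Qed.

(** Compactness gives a cluster point, and a cluster point of an ultrafilter is a limit. *)
Lemma ultra_cvg_itv (U : set_system nat) (v : nat -> R) : UltraFilter U ->
  (forall n, 0 <= v n <= 1) -> exists l : R, v @ U --> l.
Proof.
move=> UU v01; have PU := @ultra_proper _ _ UU.
have PvU : ProperFilter (v @ U) by exact: fmap_proper_filter.
have vU01 : (v @ U) `[0, 1]%classic.
  apply: (@filterE _ U _ (fun n => `[0, 1]%classic (v n))) => n.
  by rewrite /= in_itv/=; exact: v01.
have [l [_ cl]] := segment_compact PvU vU01.
exists l => A lA; rewrite /=.
have [//|UnA] := in_ultra_setVsetC (v @^-1` A) UU.
have [x []] := cl (~` A) A UnA lA; by [].
Qed.

Lemma cvg_sum_seq (T I : Type) (F : set_system T) (r : seq I) (f : I -> T -> R)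
    (l : I -> R) : Filter F -> (forall i, f i @ F --> l i) ->
  (fun x => \sum_(i <- r) f i x) @ F --> \sum_(i <- r) l i.
Proof.
move=> FF fl; elim: r => [|i r IH].
  by rewrite big_nil; under eq_fun do rewrite big_nil; exact: cvg_cst.
by rewrite big_cons; under eq_fun do rewrite big_cons; exact: cvgD.
Qed.

Lemma cvg_exprn (T : Type) (F : set_system T) (f : T -> R) (l : R) j :
  Filter F -> f @ F --> l -> (fun x => f x ^+ j) @ F --> l ^+ j.
Proof.
move=> FF fl; elim: j => [|j IH]; first by under eq_fun do rewrite expr0; exact: cvg_cst.
by rewrite exprS; under eq_fun do rewrite exprS; exact: cvgM.
Qed.

(* The measure is the image of Lebesgue measure on ]0, M] under a pointwise
   limit, along an ultrafilter, of the quantile functions.  Ultrafilter limits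
   commute with these integrals because the Riemann sums of monotone functions
   with values in [0, 1] converge uniformly. *)
Lemma quantile_limit_measure (M : R) (w : nat -> nat -> R) (m : nat -> R) :
  (forall n k, 0 <= w n k) -> (forall n, \sum_(k < n.+1) w n k = M) ->
  (forall j, (fun n => \sum_(k < n.+1) w n k * (k%:R / n%:R) ^+ j) @ \oo --> m j) ->
  exists mu : {measure set (measurableTypeR R) -> \bar R}, represents mu m.
Proof.
move=> w0 wM wm.
have M0 : 0 <= M by rewrite -(wM 0%N) sumr_ge0.
(* Refining the filter at infinity gives limits for all u at once, without extracting subsequences,
   and preserves the limits in [wm]. *)
have [U [UU sU]] := ultraFilterLemma (eventually_filter).
have PU := @ultra_proper _ _ UU.
have /choice[q qU] : forall u, exists l : R, (fun n => quantile (w n) n u) @ U --> l.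
  by move=> u; apply: ultra_cvg_itv => n; exact: quantile01.
have q01 u : 0 <= q u <= 1.
  apply/andP; split.
    by apply: (cvgr_to_ge (qU u)); apply: nearW => n; have /andP[] := quantile01 (w n) n u.
  by apply: (cvgr_to_le (qU u)); apply: nearW => n; have /andP[] := quantile01 (w n) n u.
have ndq : nondecreasing_fun q.
  move=> u v uv; apply: (ler_cvg_to (qU u) (qU v)); apply: nearW => n.
  exact: quantile_nondecreasing.
have momq j : \int[leb]_(u in `]0, M]) q u ^+ j = m j.
  have [ndj j01] := exprn_nondecreasing _ j ndq q01.
  (* Both numbers are within M / (N + 1) of the Riemann sum of q^j: the integral directly, and m j
     as the limit of the quantile integrals, each that close to its own Riemann sum. *)
  have bnd N : `|\int[leb]_(u in `]0, M]) q u ^+ j - m j| <= 2 * M * N.+1%:R^-1.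
    pose S (f : R -> R) := \sum_(i < N.+1) M / N.+1%:R * f (i%:R * (M / N.+1%:R)).
    have h1 := riemann_sum_bound _ M N.+1 ndj j01 M0 isT.
    have cS : (fun n => S (fun u => quantile (w n) n u ^+ j)) @ U --> S (fun u => q u ^+ j).
      apply: cvg_sum_seq => i; apply: cvgMr.
      exact: cvg_exprn.
    have h2 : `|m j - S (fun u => q u ^+ j)| <= M / N.+1%:R.
      have cm : (fun n => \sum_(k < n.+1) w n k * (k%:R / n%:R) ^+ j) @ U --> m j.
        by apply: cvg_trans (wm j) => A /sU.
      apply: (cvgr_to_le (cvg_norm (cvgB cm cS))); apply: nearW => n.
      have [ndn n01] := exprn_nondecreasing _ j (quantile_nondecreasing (w n) n) (quantile01 (w n) n).
      rewrite -[X in `|X|]/(\sum_(k < n.+1) w n k * (k%:R / n%:R) ^+ j -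
        S (fun u => quantile (w n) n u ^+ j)).
      rewrite -quantile_moment// wM.
      exact: (riemann_sum_bound _ M N.+1 ndn n01 M0 isT).
    rewrite (_ : _ - m j = (\int[leb]_(u in `]0, M]) q u ^+ j - S (fun u => q u ^+ j)) -
      (m j - S (fun u => q u ^+ j))); last by ring.
    rewrite (le_trans (ler_normB _ _))// (_ : 2 * M * _ = M / N.+1%:R + M / N.+1%:R); last by ring.
    exact: lerD.
  apply/eqP; rewrite -subr_eq0 -normr_le0.
  have : (fun N => 2 * M * N.+1%:R^-1) @ \oo --> 2 * M * 0.
    by apply: cvgMr; exact: cvg_harmonic.
  by rewrite mulr0 => /cvgr_to_ge; apply; apply: nearW => N; exact: bnd.
have mq : measurable_fun [set: measurableTypeR R] (q : measurableTypeR R -> measurableTypeR R).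
  exact: nondecreasing_measurable.
pose q' : measurableTypeR R -> measurableTypeR R := q.
pose D : set (measurableTypeR R) := `]0, M]%classic.
have mD : measurable D by exact: measurable_itv.
have mI : measurable_fun setT (\1_D : measurableTypeR R -> R) by exact: measurable_indic.
have I0 x : 0 <= (\1_D x : R) by [].
(* Lebesgue measure restricted to ]0, M], as a measure on the whole line. *)
pose nu := @density_measure _ (measurableTypeR R) R leb (\1_D) mI I0.
have mX j : measurable_fun [set: measurableTypeR R] (fun t : R => t ^+ j) by exact: exprn_measurable.
have mqX j : measurable_fun [set: measurableTypeR R] (fun t : R => q t ^+ j).
  exact: measurable_funX.
have qD j : (fun x : measurableTypeR R => (q x ^+ j * \1_D x)%:E) =
    (EFin \o (fun x => q x ^+ j)) \_ D.
  apply/funext => x; rewrite patchE indicE.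
  by case: (x \in D); rewrite ?mulr1 ?mulr0.
have intq j : leb.-integrable D (EFin \o (fun x => q x ^+ j)).
  by have [ndj j01] := exprn_nondecreasing _ j ndq q01; exact: nondecreasing_integrable.
have intqn j : nu.-integrable [set: measurableTypeR R] (EFin \o (fun x => q x ^+ j)).
  apply: integrable_density => //.
  by rewrite qD; apply/(integrable_mkcond _ mD); exact: intq.
exists (pushforward nu q') => j; split.
  apply: (integrable_pushforward mq) => //; first exact/measurable_EFinP.
  exact: intqn.
rewrite (integral_pushforward mq)//; [|exact/measurable_EFinP|exact: intqn].
have -> : (\int[nu]_(x in q' @^-1` setT) (q x ^+ j)%:E = \int[leb]_(x in D) (q x ^+ j)%:E)%E.
  rewrite preimage_setT.
  by rewrite [LHS](@integral_density _ _ _ leb _ mI I0 _ (mqX j)) qD -integral_mkcond.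
rewrite -momq /Rintegral fineK//; exact: integrable_fin_num (intq j).
Unshelve. exact: mq. Qed.

End MonotoneIntegral.

(** * Existence of a representing measure *)

Section Existence.
Context {R : realType}.
Implicit Types (mu : {measure set (measurableTypeR R) -> \bar R}) (gamma : R^nat).

(** A finite limsup gives a tail on which the roots are at most r; the finitely many earlier terms
    are absorbed by C. *)
Lemma at_most_exponential_bound gamma : at_most_exponential gamma ->
  exists C r, 0 < r /\ forall n, `|gamma n| <= C * r ^+ n.
Proof.
move=> /ereal_inf_lt[_ [V [N _ NV] <-] supV].
pose x := fine (ereal_sup [set (`|gamma n| `^ n%:R^-1)%:E | n in V]).
(* With r >= 1, also r^n >= 1, so C alone covers the initial indices. *)
pose r := Num.max x 1.
have r1 : 1 <= r by rewrite le_max lexx orbT.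
have r0 : 0 < r by exact: lt_le_trans r1.
pose C := 1 + \sum_(i < N.+1) `|gamma i|.
have C1 : 1 <= C by rewrite lerDl sumr_ge0.
exists C, r; split=> // n; have [nN|Nn] := leqP n N.
  apply: (@le_trans _ _ C); last by rewrite ler_peMr ?exprn_ege1// (le_trans ler01).
  rewrite /C (bigD1 (Ordinal (nN : n < N.+1)%N))//= addrCA lerDl.
  by rewrite addr_ge0// sumr_ge0.
have n0 : (0 < n)%N by exact: leq_ltn_trans Nn.
have h : `|gamma n| `^ n%:R^-1 <= r.
  have : ((`|gamma n| `^ n%:R^-1)%:E <=
      ereal_sup [set (`|gamma n| `^ n%:R^-1)%:E | n in V])%E.
    by apply: ereal_sup_ubound; exists n => //; apply: NV; exact: ltnW.
  rewrite /r /x; case: (ereal_sup _) supV => [y| |]//= _.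
  by rewrite lee_fin le_max => ->.
apply: (@le_trans _ _ (r ^+ n)); last by rewrite ler_peMl// exprn_ge0// ltW.
rewrite -[leLHS]powRr1// -(mulVf (_ : n%:R != 0 :> R)) ?pnatr_eq0 -?lt0n//.
by rewrite powRrM powR_mulrn ?powR_ge0// lerXn2r ?nnegrE ?powR_ge0// ltW.
Qed.

Lemma moment_functional_comp gamma (m : R^nat) (p q : {poly R}) :
  (forall j, m j = moment_functional gamma (q ^+ j)) ->
  moment_functional m p = moment_functional gamma (p \Po q).
Proof.
move=> mE; rewrite comp_polyE linear_sum/=; apply: eq_bigr => i _.
by rewrite linearZ/= mE.
Qed.

Lemma positive_definite_hamburger gamma (C r : R) : 0 < r ->
  (forall n, `|gamma n| <= C * r ^+ n) -> positive_definite gamma ->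
  hamburger_moment_sequence gamma.
Proof.
move=> r0 growth /positive_definiteP pos.
have r2 : 2 * r != 0 by rewrite mulf_neq0// gt_eqF.
(* A is the affine map of [-r, r] onto [0, 1], and B = 1 - A. *)
pose A : {poly R} := (2 * r)^-1 *: (r%:P + 'X).
pose B : {poly R} := (2 * r)^-1 *: (r%:P - 'X).
have AB1 : A + B = 1.
  rewrite /A /B -scalerDr addrACA subrr addr0 -polyCD -mul_polyC -polyCM.
  have -> : (2 * r)^-1 * (r + r) = 1 by field; rewrite gt_eqF.
  by [].
pose m j := moment_functional gamma (A ^+ j).
pose w n k := 'C(n, k)%:R * moment_functional gamma (A ^+ k * B ^+ (n - k)).
have w0 n k : 0 <= w n k.
  rewrite /w mulr_ge0// /A /B !exprZn -scalerAl -scalerAr scalerA linearZ/=.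
  apply: mulr_ge0; first by rewrite mulr_ge0// exprn_ge0// invr_ge0 mulr_ge0// ltW.
  exact: positive_functional_bernstein r0 growth pos _ _.
have wM n : \sum_(k < n.+1) w n k = gamma 0%N.
  have := bernstein_moment gamma _ _ n 0 AB1 (leq0n n).
  rewrite expr0 -(moment_functionalXn gamma 0) expr0 => <-.
  by apply: eq_bigr => k _; rewrite !bin0 divr1 mul1r.
(* By [bernstein_moment], m j is the same sum with C(k, j) / C(n, j) in place of (k / n)^j. The
   error in [bin_ratio_bound] is uniform in k, and the weights sum to gamma_0. *)
have wm j : (fun n => \sum_(k < n.+1) w n k * (k%:R / n%:R) ^+ j) @ \oo --> m j.
  pose e n := gamma 0%N * ((j ^ 2)%:R / (n - j)%:R).
  have e0 : e @ \oo --> 0.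
    rewrite -[X in _ --> X](mulr0 (gamma 0%N)); apply: cvgMr.
    rewrite -[X in _ --> X](mulr0 (j ^ 2)%:R); apply: cvgMr.
    rewrite -(cvg_shiftn j.+1); under eq_fun do rewrite addnS subSn ?leq_addl// addnK.
    exact: cvg_harmonic.
  apply: (@squeeze_cvgr _ _ _ _ (fun n => m j - e n) (fun n => m j + e n)).
  - near=> n; have jn : (j < n)%N by near: n; exact: nbhs_infty_gt.
    rewrite -ler_distl /m -(bernstein_moment gamma _ _ n j AB1 (ltnW jn)).
    rewrite distrC -sumrB /e -(wM n) mulr_suml.
    rewrite (le_trans (ler_norm_sum _ _ _))//; apply: ler_sum => k _.
    rewrite -/(w n k) [_ * w n k]mulrC -mulrBr normrM (ger0_norm (w0 _ _)).
    by rewrite ler_wpM2l// bin_ratio_bound// -ltnS.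
  - by rewrite -[X in _ --> X]subr0; apply: cvgB => //; exact: cvg_cst.
  - by rewrite -[X in _ --> X]addr0; apply: cvgD => //; exact: cvg_cst.
have [mu0 rep0] := quantile_limit_measure _ _ _ w0 wM wm.
(* The inverse of A; pushing [mu0] forward along it undoes the change of variable. *)
pose p : {poly R} := (2 * r) *: 'X - r%:P.
have pA n : moment_functional m (p ^+ n) = gamma n.
  rewrite (moment_functional_comp gamma _ _ A)// -moment_functionalXn; congr moment_functional.
  rewrite rmorphXn/= /p linearB/= linearZ/= comp_polyX comp_polyC /A scalerA mulfV//.
  by rewrite scale1r addrAC subrr add0r.
have mp : measurable_fun [set: measurableTypeR R]
    ((fun x => p.[x]) : measurableTypeR R -> measurableTypeR R).
  exact: measurable_horner.
pose phi : measurableTypeR R -> measurableTypeR R := fun x => p.[x].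
have phiX n : (fun x => (p.[x] ^+ n)%:E) = (fun x => ((p ^+ n).[x])%:E).
  by apply/funext => x; rewrite horner_exp.
have mX n : measurable_fun [set: measurableTypeR R] (fun t : R => (t ^+ n)%:E).
  by apply/measurable_EFinP; exact: exprn_measurable.
have intp n : mu0.-integrable [set: measurableTypeR R] (fun x => (p.[x] ^+ n)%:E).
  by rewrite phiX; exact: (represents_poly _ _ _ rep0).1.
exists (pushforward mu0 phi) => n; split.
  by apply: (integrable_pushforward mp) => //; exact: intp.
rewrite (integral_pushforward mp)//; last exact: intp.
rewrite preimage_setT -pA -(represents_poly _ _ (p ^+ n) rep0).2.
by apply: eq_integral => x _ /=; rewrite horner_exp.
Unshelve. all: by end_near. Qed.

Lemma hamburger_positive_definite gamma :
  hamburger_moment_sequence gamma -> positive_definite gamma.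
Proof.
move=> [mu rep]; apply/positive_definiteP => p.
rewrite -lee_fin -(represents_poly _ _ _ rep).2; apply: integral_ge0 => x _.
by rewrite lee_fin horner_exp sqr_ge0.
Qed.

End Existence.

(** * Representing triplets *)

Section Triplets.
Context {R : realType}.
Implicit Types (mu nu : {measure set (measurableTypeR R) -> \bar R}).
Implicit Types (gamma m : R^nat) (b c r : R).

(** Continuity gives measurability away from a, and the singleton is treated separately. *)
Lemma measurable_subV (a : R) :
  measurable_fun [set: measurableTypeR R] (fun x : R => (x - a)^-1).
Proof.
have mA : measurable ([set a] : set (measurableTypeR R)) by exact: measurable_set1.
rewrite -(setUv [set a]) setUC; apply/measurable_funU => //; first exact: measurableC.
split; last exact: measurable_fun_set1.
apply: open_continuous_measurable_fun.
  apply: closed_openC; apply: accessible_closed_set1.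
  by apply: hausdorff_accessible; exact: Rhausdorff.
move=> x; rewrite inE/= => xa; apply: (@continuousV R R (fun y : R => y - a) x).
  by rewrite subr_eq0; exact/eqP.
by apply: continuousB; [exact: cvg_id|exact: cst_continuous].
Qed.

Definition sq_sub1 (x : R) : R := (x - 1) ^+ 2.
(** Its value at 1 is 0, so its product with [sq_sub1] is the indicator of x != 1. *)
Definition isq_sub1 (x : R) : R := (x - 1) ^- 2.

Lemma sq_sub1_ge0 x : 0 <= sq_sub1 x. Proof. exact: sqr_ge0. Qed.

Lemma isq_sub1_ge0 x : 0 <= isq_sub1 x. Proof. by rewrite invr_ge0 sqr_ge0. Qed.

Lemma measurable_sq_sub1 : measurable_fun [set: measurableTypeR R] sq_sub1.
Proof. by apply: measurable_funX; apply: measurable_funB. Qed.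

Lemma measurable_isq_sub1 : measurable_fun [set: measurableTypeR R] isq_sub1.
Proof.
rewrite (_ : isq_sub1 = fun x => ((x - 1)^-1) ^+ 2).
  by apply: measurable_funX; exact: measurable_subV.
by apply/funext => x; rewrite exprVn.
Qed.

Local Notation sq_density nu :=
  (@density_measure _ (measurableTypeR R) R nu sq_sub1 measurable_sq_sub1 sq_sub1_ge0).

Lemma sq_sub1K x : x != 1 -> isq_sub1 x * sq_sub1 x = 1.
Proof. by move=> x1; rewrite mulVf// expf_neq0// subr_eq0. Qed.

Lemma Q_S n : Q R n.+1 = Q R n + \sum_(j < n) 'X^j.
Proof.
have -> : \sum_(j < n) 'X^j = \poly_(j < n) (1 : R).
  by rewrite poly_def; apply: eq_bigr => i _; rewrite scale1r.
apply/polyP => i; rewrite coefD !coef_poly /=.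
have [iltn|nlei] := ltnP i n; last by rewrite ltnNge (leq_trans (leq_pred _) nlei) addr0.
have [in1|n1i] := ltnP i n.-1; first by rewrite natr1; congr (_%:R); lia.
by rewrite add0r (_ : (n.+1 - i - 1)%N = 1%N)//; lia.
Qed.

(** By [Q_S] the increments of Q are geometric sums, and X - 1 times such a sum is X^n - 1. *)
Lemma Q_mul n : Q R n * ('X - 1) ^+ 2 = 'X^n - 1 - n%:R *: ('X - 1).
Proof.
elim: n => [|n IH].
  rewrite (_ : Q R 0 = 0) ?mul0r ?scale0r ?expr0 ?subrr ?subr0//.
  by apply/polyP => i; rewrite coef_poly coef0.
rewrite Q_S mulrDl IH expr2 mulrCA [_ * ('X - 1)]mulrC -subrX1.
rewrite -natr1 -!mul_polyC polyCD exprS.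
by rewrite polyC1; ring.
Qed.

Lemma horner_Q n x : (Q R n).[x] * sq_sub1 x = x ^+ n - 1 - n%:R * (x - 1).
Proof.
by have /(congr1 (horner^~ x)) := Q_mul n; rewrite hornerM horner_exp !hornerE.
Qed.

Lemma represents_sq_density m nu : represents nu m ->
  represents (sq_density nu)
    (fun n => m n.+2 - 2 * m n.+1 + m n).
Proof.
move=> rep n; pose p : {poly R} := 'X^(n.+2) - (2 : R) *: 'X^(n.+1) + 'X^n.
have pE : (fun x : measurableTypeR R => (x ^+ n * sq_sub1 x)%:E) = (fun x => (p.[x])%:E).
  by apply/funext => x; rewrite /p !hornerE/= /sq_sub1 !exprS; congr EFin; ring.
have [intp ip] := represents_poly _ _ p rep.
have mX : measurable_fun [set: measurableTypeR R] (fun t : R => t ^+ n) by exact: exprn_measurable.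
split; first by apply: integrable_density => //; rewrite pE.
rewrite integral_density// pE ip /p linearD/= linearB/=.
rewrite [moment_functional m (2 *: _)]linearZ/=; by rewrite !moment_functionalXn.
Qed.

Lemma supported_in_density nu r : supported_in nu r ->
  supported_in (sq_density nu) r.
Proof.
move=> supp; apply: null_set_integral => //; first exact: measurable_norm_gt.
by apply/measurable_EFinP; apply: measurable_funTS; exact: measurable_sq_sub1.
Qed.

Lemma supported_in_le nu r r' : r <= r' -> supported_in nu r -> supported_in nu r'.
Proof.
move=> rr' supp; apply/eqP; rewrite -measure_le0 -[leRHS]supp.
apply: le_measure; rewrite ?inE; try exact: measurable_norm_gt.
by move=> x /=; exact: le_lt_trans.
Qed.

(** The density and its inverse cancel except at 1, which nu does not charge. *)
Lemma integral_isq_density nu (A : set (measurableTypeR R)) :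
  nu [set 1] = 0%E -> measurable A ->
  (\int[sq_density nu]_(x in A)
     (isq_sub1 x)%:E)%E = nu A.
Proof.
move=> nu1 mA.
have mi : measurable_fun A (fun x : measurableTypeR R => (isq_sub1 x)%:E).
  by apply/measurable_EFinP; apply: measurable_funTS; exact: measurable_isq_sub1.
rewrite ge0_integral_density//; last by move=> x; rewrite lee_fin isq_sub1_ge0.
transitivity (\int[nu]_(x in A) cst 1%E x)%E; last by rewrite integral_cst// mul1e.
apply: ae_eq_integral => //.
  apply: emeasurable_funM => //; apply/measurable_EFinP; apply: measurable_funTS.
  exact: measurable_sq_sub1.
exists [set 1]; split => //.
move=> x /= /not_implyP[_]; apply: contra_notP => /eqP x1.
by rewrite -EFinM sq_sub1K.
Qed.

(** Second differences kill the affine part of gamma, turn c n^2 into 2c and turn Q_n into x^n. *)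
Lemma triplet_moments gamma b c (nu : {finite_measure set (measurableTypeR R) -> \bar R}) :
  representing_triplet gamma b c nu ->
  exists r m, [/\ 0 < r, supported_in nu r, represents nu m,
    forall n, m n = gamma n.+2 - 2 * gamma n.+1 + gamma n - 2 * c
    & forall n, gamma n = gamma 0%N + b * n%:R + c * n%:R ^+ 2 + moment_functional m (Q R n)].
Proof.
move=> [_ /compactly_supported_in[r r0 supp] _ gE].
have fin : (nu setT < +oo)%E by rewrite -ge0_fin_numE// fin_num_measure.
have rep := supported_represents _ _ supp fin.
set m := (X in represents nu X) in rep.
have gE' n : gamma n = gamma 0%N + b * n%:R + c * n%:R ^+ 2 + moment_functional m (Q R n).
  by have := gE n; rewrite (represents_poly _ _ _ rep).2 -EFinD => -[].
exists r, m; split => // n.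
have -> : m n = moment_functional m (Q R n.+2) - 2 * moment_functional m (Q R n.+1)
    + moment_functional m (Q R n).
  rewrite !Q_S big_ord_recr/= !linearD/= moment_functionalXn; ring.
rewrite (gE' n.+2) (gE' n.+1) (gE' n) -!natr1; ring.
Qed.

(* The second differences of gamma are the moments of nu up to the constant 2c;
   the density (x - 1) ^ 2 removes that constant. *)
Lemma representing_triplet_unique gamma b c b' c'
    (nu nu' : {finite_measure set (measurableTypeR R) -> \bar R}) :
  representing_triplet gamma b c nu -> representing_triplet gamma b' c' nu' ->
  [/\ b' = b, c' = c
    & forall A : set (measurableTypeR R), measurable A -> nu' A = nu A].
Proof.
move=> t t'; have [_ _ nu1 _] := t; have [_ _ nu1' _] := t'.
have [r [m [r0 supp rep mE gE]]] := triplet_moments _ _ _ _ t.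
have [r' [m' [r0' supp' rep' mE' gE']]] := triplet_moments _ _ _ _ t'.
have dE : (fun n => m n.+2 - 2 * m n.+1 + m n) = (fun n => m' n.+2 - 2 * m' n.+1 + m' n).
  by apply/funext => n; rewrite !mE !mE'; ring.
have srep := represents_sq_density _ _ rep; rewrite dE in srep.
have srep' := represents_sq_density _ _ rep'.
pose r1 := Num.max r r'.
have h1 := supported_in_le _ _ r1 (_ : r <= r1) (supported_in_density _ _ supp).
have h2 := supported_in_le _ _ r1 (_ : r' <= r1) (supported_in_density _ _ supp').
have E := bounded_moments_unique _ _ _ _ _ (h1 _) (h2 _) srep srep'.
have nuE A : measurable A -> nu' A = nu A.
  move=> mA; rewrite -(integral_isq_density _ _ nu1 mA) -(integral_isq_density _ _ nu1' mA).
  apply: eq_measure_integral => B mB _; apply/esym/E => //.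
  - by rewrite lt_max r0.
  - by rewrite le_max lexx.
  - by rewrite le_max lexx orbT.
(* The mass of nu determines c through the second difference of gamma at 0; then gamma_1 determines
   b, because Q_1 = 0. *)
have m0 : m 0%N = m' 0%N.
  have e : nu setT = (m 0%N)%:E := represents_finite _ _ rep.
  have e' : nu' setT = (m' 0%N)%:E := represents_finite _ _ rep'.
  by apply: EFin_inj; rewrite -e -e' nuE.
have cE : c' = c by have := m0; rewrite mE mE'; lra.
split => //; have := gE 1%N; rewrite (gE' 1%N) cE.
have -> : Q R 1 = 0 by apply/polyP => i; rewrite coef_poly coef0.
by rewrite !linear0; lra.
Qed.

(** Here nu has density (x - 1)^2 with respect to mu, and b is the mu-integral of x - 1; integrating
    x^n = 1 + n (x - 1) + Q_n(x) (x - 1)^2 gives the representation with c = 0. *)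
Lemma moments_triplet gamma mu r : represents mu gamma -> supported_in mu r ->
  exists nu : {finite_measure set (measurableTypeR R) -> \bar R},
  [/\ forall A : set (measurableTypeR R), measurable A ->
        nu A = (\int[mu]_(x in A) ((x - 1) ^+ 2)%:E)%E,
      representing_triplet gamma (gamma 1%N - gamma 0%N) 0 nu
    & triplet_conditions gamma (gamma 1%N - gamma 0%N) 0 nu].
Proof.
move=> rep supp.
pose D : {measure set (measurableTypeR R) -> \bar R} := sq_density mu.
have srep := represents_sq_density _ _ rep.
have fin : fin_num_fun D.
  by apply: lty_fin_num_fun; rewrite (represents_finite _ _ srep) ltry.
pose nu : {finite_measure set (measurableTypeR R) -> \bar R} :=
  HB.pack (Measure.sort D) (Measure_isFinite.Build _ _ _ D fin).
have intE f : measurable_fun [set: measurableTypeR R] f ->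
    (\int[nu]_x (f x)%:E = \int[mu]_x (f x * sq_sub1 x)%:E)%E.
  by move=> mf; exact: (integral_density _ _ _ mu _ measurable_sq_sub1 sq_sub1_ge0 f mf).
exists nu; split => //.
- split => //.
  + exact: supported_in_compact (supported_in_density _ _ supp).
  + rewrite -[LHS]/(\int[mu]_(x in [set 1%R]) (sq_sub1 x)%:E)%E.
    apply: integral0_eq => x /= ->.
    by rewrite /sq_sub1 subrr expr0n.
  + move=> n; rewrite intE; last exact: measurable_horner.
    pose p : {poly R} := 'X^n - 'X^0 - n%:R *: ('X^1 - 'X^0).
    transitivity ((gamma 0%N + (gamma 1%N - gamma 0%N) * n%:R + 0 * n%:R ^+ 2)%:E +
        \int[mu]_x (p.[x])%:E)%E.
      rewrite (represents_poly _ _ p rep).2 -EFinD; congr EFin.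
      rewrite /p linearB/= [moment_functional gamma (_ *: _)]linearZ/= !linearB/=.
      by rewrite !moment_functionalXn; ring.
    congr (_ + _)%E; apply: eq_integral => x _; congr EFin.
    rewrite -[RHS]/((Q R n).[x] * sq_sub1 x).
    by rewrite horner_Q /p !hornerE.
- split => //.
  (* The integral is the mu-mass of the complement of {1}, at most the total mass gamma_0. *)
  + rewrite (intE isq_sub1 measurable_isq_sub1) -(represents_finite _ _ rep).
    rewrite -[leRHS]mul1e -integral_cst//; apply: ge0_le_integral => //.
    * by move=> x _; rewrite lee_fin mulr_ge0 ?isq_sub1_ge0 ?sq_sub1_ge0.
    * apply/measurable_EFinP; apply: measurable_funM.
        exact: measurable_isq_sub1.
      exact: measurable_sq_sub1.
    * move=> x _; rewrite lee_fin; have [->|x1] := eqVneq x 1.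
        by rewrite /sq_sub1 subrr expr0n mulr0.
      by rewrite sq_sub1K.
  + rewrite (intE _ (measurable_subV 1)).
    pose p : {poly R} := 'X^1 - 'X^0.
    transitivity (\int[mu]_x (p.[x])%:E)%E.
      by rewrite (represents_poly _ _ p rep).2 /p linearB/= !moment_functionalXn.
    apply: eq_integral => x _; congr EFin.
    have -> : p.[x] = x - 1 by rewrite /p !hornerE.
    rewrite /sq_sub1; have [->|x1] := eqVneq x 1; first by rewrite subrr expr0n mulr0.
    by rewrite expr2 mulKf// subr_eq0.
Qed.

(** Dividing x^n = 1 + n (x - 1) + Q_n(x) (x - 1)^2 by (x - 1)^2 and integrating against nu gives
    gamma_n up to a constant independent of n. A point mass at 1, whose moments are all equal,
    supplies it. *)
Lemma triplet_measure gamma b c (nu : {finite_measure set (measurableTypeR R) -> \bar R}) :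
  representing_triplet gamma b c nu -> triplet_conditions gamma b c nu ->
  exists2 mu, represents mu gamma &
    forall A : set (measurableTypeR R), measurable A ->
      mu A = (\int[nu]_(x in A) ((x - 1) ^- 2)%:E
              + ((gamma 0%N)%:E - \int[nu]_x ((x - 1) ^- 2)%:E)
                * \d_(1%R : measurableTypeR R) A)%E.
Proof.
move=> [_ /compactly_supported_in[r r0 supp] nu1 gE] [i2 i1 c0].
have fin : (nu setT < +oo)%E by rewrite -ge0_fin_numE// fin_num_measure.
pose s := fine (\int[nu]_x ((x - 1) ^- 2)%:E)%E.
have i2_ge0 : (0 <= \int[nu]_x ((x - 1) ^- 2)%:E)%E.
  by apply: integral_ge0 => x _; rewrite lee_fin isq_sub1_ge0.
have sE : (\int[nu]_x ((x - 1) ^- 2)%:E)%E = s%:E.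
  by rewrite fineK// ge0_fin_numE// (le_lt_trans i2)// ltry.
pose k (_ : R) : R := gamma 0%N - s.
have k0 x : 0 <= k x by rewrite subr_ge0 -lee_fin -sE.
have mk : measurable_fun [set: measurableTypeR R] k by exact: measurable_cst.
pose D1 := @density_measure _ (measurableTypeR R) R nu isq_sub1 measurable_isq_sub1 isq_sub1_ge0.
(* Written as a density over the Dirac measure so that the same lemmas serve both summands. *)
pose D2 := @density_measure _ (measurableTypeR R) R (\d_(1 : measurableTypeR R)) k mk k0.
have int2 : nu.-integrable [set: measurableTypeR R] (EFin \o isq_sub1).
  apply/integrableP; split; first by apply/measurable_EFinP; exact: measurable_isq_sub1.
  under eq_integral do rewrite /= ger0_norm ?isq_sub1_ge0//.
  by rewrite [ltLHS]sE ltry.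
have cint a : nu.-integrable [set: measurableTypeR R] (EFin \o cst a).
  exact: finite_measure_integrable_cst.
have int1 : nu.-integrable [set: measurableTypeR R] (fun x => ((x - 1)^-1)%:E).
  apply: (@le_integrable _ _ _ nu setT measurableT _
    (fun x : measurableTypeR R => (1 + isq_sub1 x)%:E)).
  - by apply/measurable_EFinP; exact: measurable_subV.
  - move=> x _; rewrite /= lee_fin [leRHS]ger0_norm ?addr_ge0 ?isq_sub1_ge0//.
    rewrite /isq_sub1 -exprVn; set y := _^-1.
    have := sqr_ge0 (`|y| - 1); rewrite sqrrB1 real_normK ?num_real//.
    by have := sqr_ge0 y; lra.
  - exact: (integrableD measurableT (cint 1) int2).
(* Q_n with its value at 1 replaced by 0: nu-almost everywhere the same, and the division identity
   [xE] then holds at every x. *)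
pose h n x : R := (Q R n).[x] * (sq_sub1 x * isq_sub1 x).
have mh n : measurable_fun [set: measurableTypeR R] (h n).
  apply: measurable_funM; first exact: measurable_horner.
  by apply: measurable_funM; [exact: measurable_sq_sub1|exact: measurable_isq_sub1].
have hE n x : x != 1 -> h n x = (Q R n).[x].
  by move=> x1; rewrite /h [_ * isq_sub1 x]mulrC sq_sub1K// mulr1.
have inth n : nu.-integrable [set: measurableTypeR R] (EFin \o h n).
  apply: supported_integrable supp fin (mh n) _ => x xr.
  apply: le_trans (horner_bound (Q R n) r x xr).
  have [->|x1] := eqVneq x 1; first by rewrite /h /sq_sub1 subrr expr0n mul0r mulr0 normr0.
  by rewrite hE.
have ih n : (\int[nu]_x (h n x)%:E = \int[nu]_x ((Q R n).[x])%:E)%E.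
  apply: ae_eq_integral => //.
  - by apply/measurable_EFinP; exact: mh.
  - by apply/measurable_EFinP; exact: measurable_horner.
  exists [set 1]; split => //.
  move=> x /= /not_implyP[_]; apply: contra_notP => /eqP x1.
  by rewrite hE.
have xE n : (fun x : measurableTypeR R => (x ^+ n * isq_sub1 x)%:E) =
    (fun x => ((isq_sub1 x)%:E + n%:R%:E * ((x - 1)^-1)%:E) + (h n x)%:E)%E.
  apply/funext => x; rewrite -EFinM -!EFinD; congr EFin; rewrite /h.
  rewrite mulrA horner_Q /isq_sub1.
  have [->|x1] := eqVneq x 1; first by rewrite subrr expr0n/= invr0 !mulr0 !addr0.
  by field; rewrite subr_eq0.
have mX n : measurable_fun [set: measurableTypeR R] (fun t : R => t ^+ n) by exact: exprn_measurable.
have int1n n : nu.-integrable [set: measurableTypeR R] (fun x => n%:R%:E * ((x - 1)^-1)%:E)%E.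
  exact: integrableZl.
have intx n : nu.-integrable [set: measurableTypeR R] (fun x => (x ^+ n * isq_sub1 x)%:E).
  rewrite xE.
  exact: (integrableD measurableT (integrableD measurableT int2 (int1n n)) (inth n)).
have int_D1 n : D1.-integrable [set: measurableTypeR R] (fun x => (x ^+ n)%:E).
  by apply: integrable_density => //; exact: intx.
(* The three integrals are s, n b and that of Q_n; with c = 0 they add up to gamma_n - gamma_0 +
   s. *)
have iD1 n : (\int[D1]_x (x ^+ n)%:E = (gamma n - k 0)%:E)%E.
  rewrite (integral_density _ _ _ nu _ measurable_isq_sub1 isq_sub1_ge0 _ (mX n)) xE.
  rewrite (integralD measurableT (integrableD measurableT int2 (int1n n)) (inth n)).
  rewrite (integralD measurableT int2 (int1n n)) integralZl// ih -i1 [X in (X + _ + _)%E]sE.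
  have := gE n; rewrite c0 mul0r addr0; case: (\int[nu]_x _)%E => // q.
  by rewrite -EFinD => -[->]; rewrite -EFinM -!EFinD; congr EFin; rewrite /k; ring.
have int_D2 n : D2.-integrable [set: measurableTypeR R] (fun x => (x ^+ n)%:E).
  apply: integrable_density => //; apply/integrableP; split.
    by apply/measurable_EFinP; exact: measurable_funM.
  rewrite integral_dirac//; last first.
    by apply/measurable_EFinP; apply: measurableT_comp => //; exact: measurable_funM.
  by rewrite diracT mul1e ltry.
have iD2 n : (\int[D2]_x (x ^+ n)%:E = (k 0)%:E)%E.
  rewrite (integral_density _ _ _ (\d_(1 : measurableTypeR R)) _ mk k0 _ (mX n)).
  rewrite integral_dirac//; last by apply/measurable_EFinP; exact: measurable_funM.
  by rewrite diracT mul1e expr1n mul1r.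
exists (measure_add D1 D2).
  move=> n; split.
    apply/integrableP; split; first exact/measurable_EFinP.
    rewrite ge0_integral_measure_add//; last first.
      by apply/measurable_EFinP; apply: measurableT_comp.
    have /integrableP[_ l1] := int_D1 n; have /integrableP[_ l2] := int_D2 n.
    exact: lte_add_pinfty l1 l2.
  by rewrite (integral_measure_add measurableT (int_D1 n) (int_D2 n)) iD1 iD2 -EFinD subrK.
move=> A mA; transitivity (D1 A + D2 A)%E; first exact: measure_addE.
congr (_ + _)%E.
rewrite sE -EFinB -[LHS]/(\int[\d_(1%R : measurableTypeR R)]_(x in A) (k x)%:E)%E.
exact: (integral_cst _ mA (gamma 0%N - s)%:E).
Qed.

End Triplets.

Theorem theorem2p2p12 (R : realType) (gamma : R^nat)
    (hgamma : at_most_exponential gamma) :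
  [/\ positive_definite gamma <-> hamburger_moment_sequence gamma,
      hamburger_moment_sequence gamma <->
        (conditionally_positive_definite gamma /\
         exists (b c : R)
                (nu : {finite_measure set (measurableTypeR R) -> \bar R}),
           [/\ representing_triplet gamma b c nu,
               forall (b' c' : R)
                 (nu' : {finite_measure set (measurableTypeR R) -> \bar R}),
                 representing_triplet gamma b' c' nu' ->
                 [/\ b' = b, c' = c
                   & forall A : set (measurableTypeR R),
                       measurable A -> nu' A = nu A]
             & triplet_conditions gamma b c nu])
    & forall (b c : R)
             (nu : {finite_measure set (measurableTypeR R) -> \bar R}),
        conditionally_positive_definite gamma ->
        representing_triplet gamma b c nu ->
        triplet_conditions gamma b c nu ->
        determinate gamma /\
        forall mu : {measure set (measurableTypeR R) -> \bar R},
          represents mu gamma ->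
          [/\ compactly_supported mu,
              forall A : set (measurableTypeR R), measurable A ->
                mu A = (\int[nu]_(x in A) ((x - 1) ^- 2)%:E
                        + ((gamma 0%N)%:E - \int[nu]_x ((x - 1) ^- 2)%:E)
                          * \d_(1%R : measurableTypeR R) A)%E,
              b%:E = (\int[mu]_x (x - 1)%:E)%E
            & forall A : set (measurableTypeR R), measurable A ->
                nu A = (\int[mu]_(x in A) ((x - 1) ^+ 2)%:E)%E]].
Proof.
have [C [r [r0 growth]]] := at_most_exponential_bound _ hgamma.
have supp mu : represents mu gamma -> supported_in mu r.
  by move=> rep; exact: represents_supported rep r0 growth.
have pdh : positive_definite gamma <-> hamburger_moment_sequence gamma.
  split; last exact: hamburger_positive_definite.
  exact: positive_definite_hamburger r0 growth.
have detg : hamburger_moment_sequence gamma -> determinate gamma.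
  move=> h; split => // mu1 mu2 rep1 rep2.
  exact: bounded_moments_unique r0 (supp _ rep1) (supp _ rep2) rep1 rep2.
split => //.
- split=> [hamb|[_ [b [c [nu [tri _ cond]]]]]]; last first.
    by have [mu rep _] := triplet_measure _ _ _ _ tri cond; exists mu.
  split; first by move=> k lambda _; apply: (pdh.2 hamb).
  have [mu rep] := hamb.
  have [nu [_ tri cond]] := moments_triplet _ _ _ rep (supp _ rep).
  exists (gamma 1%N - gamma 0%N), 0, nu; split => // b' c' nu' tri'.
  exact: representing_triplet_unique tri tri'.
- move=> b c nu _ tri cond.
  have [mu0 rep0 mu0E] := triplet_measure _ _ _ _ tri cond.
  have [hamb det] := detg (ex_intro _ mu0 rep0).
  split => // mu rep.
  (* The triplet built from mu agrees with the given one, so b and nu are read off from mu; the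
     formula for mu itself comes from [mu0] by determinacy. *)
  have [nu' [nu'E tri' _]] := moments_triplet _ _ _ rep (supp _ rep).
  have [bE _ nuE] := representing_triplet_unique _ _ _ _ _ _ _ tri' tri.
  split.
  + exact: supported_in_compact (supp _ rep).
  + by move=> A mA; rewrite (det mu mu0)// mu0E.
  + rewrite bE; pose p : {poly R} := 'X^1 - 'X^0.
    transitivity (\int[mu]_x (p.[x])%:E)%E.
      by rewrite (represents_poly _ _ p rep).2 /p linearB/= !moment_functionalXn.
    by apply: eq_integral => x _; rewrite /p !hornerE.
  + by move=> A mA; rewrite nuE// nu'E.
Qed.
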